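(* Let $x_t(\alpha)$ be a solution (in the sense of the context) of $$\dot{x}_t(\alpha) = \int_{0}^{1} w(t,\alpha,\beta,x_t(\alpha),x_t(\beta))\,(x_t(\beta)-x_t(\alpha))\,d\beta .$$ If $w$ is symmetric, nonnegative, and belongs to $\Gamma(r,\Delta)$ for some $r>0$, $\Delta>0$, then $x_t(\alpha)$ converges as $t\to\infty$ for almost all $\alpha$. Moreover, there exist a finite number of points $z_1,z_2,\dots,z_k\in[0,1]$ with $|z_i-z_j|\ge r$ for all $i\ne j$ such that $\lim_{t\to\infty}x_t(\alpha)\in\{z_1,\dots,z_k\}$ for almost all $\alpha$.
   Context: The weight function $w:[0,\infty)\times[0,1]\times[0,1]\times\mathbb{R}\times\mathbb{R}\to[0,\infty)$ is jointly measurable in all its variables and bounded: $w\le W$ for some constant $W<\infty$. Symmetric means $w(t,\alpha,\beta,x_t(\alpha),x_t(\beta))=w(t,\beta,\alpha,x_t(\beta),x_t(\alpha))$ for all $t,\alpha,\beta$. For $r>0,\Delta>0$, $w\in\Gamma(r,\Delta)$ means: for all $t,\alpha,\beta$, if $|x_t(\alpha)-x_t(\beta)|\le r$ then $w(t,\alpha,\beta,x_t(\alpha),x_t(\beta))\ge\Delta$. A solution is a function $(t,\alpha)\mapsto x_t(\alpha)$ from $[0,\infty)\times[0,1]$ to $\mathbb{R}$ such that: $x_t(\cdot)$ is measurable for each $t$; for each $\alpha\in[0,1]$, $t\mapsto x_t(\alpha)$ is absolutely continuous (on bounded intervals) and the equation holds for almost all $t$; $x_0(\alpha)\in[0,1]$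 for all $\alpha$; and $\sup_{\alpha\in[0,1],\,t\le T}|x_t(\alpha)|<\infty$ for every $T\ge 0$. *)

(* Defs.v *)
From HB Require Import structures.
From mathcomp Require Import all_boot all_order all_algebra.
From mathcomp Require Import all_classical all_reals all_analysis.
Set Implicit Arguments.
Unset Strict Implicit.
Unset Printing Implicit Defensive.
Import Order.TTheory GRing.Theory Num.Theory.
Import numFieldNormedType.Exports.
Local Open Scope classical_set_scope.
Local Open Scope ring_scope.

(* The real line with the sigma-algebra of Lebesgue measurable sets: the type
   on which [completed_lebesgue_measure] is a measure.  The type [R] itself
   carries the Borel sigma-algebra. *)
Definition lebesgueR (R : realType) :=
  caratheodory_type ((wlength (@idfun R))^*)%mu.

(* Functions of time and of agents are total on [R]; only their values for
   [0 <= t] and for agents in [`[0, 1]] are constrained below. *)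
Definition weight_domain (R : realType) : set (R * R * R * R * R) :=
  [set p | let: (t, a, b, _, _) := p in
           [/\ 0 <= t, 0 <= a <= 1 & 0 <= b <= 1]].

(* [w] is Borel in all its variables, so that
   [b |-> w t a b (x t a) (x t b)] is Lebesgue measurable whenever [x t] is. *)
Record weight_function (R : realType) (w : R -> R -> R -> R -> R -> R) : Prop :=
  WeightFunction {
    weight_measurable : measurable_fun (@weight_domain R)
      (fun p : R * R * R * R * R =>
         let: (t, a, b, y, z) := p in w t a b y z);
    weight_ge0 : forall t a b y z, weight_domain (t, a, b, y, z) ->
      0 <= w t a b y z;
    weight_bounded : exists W, forall t a b y z,
      weight_domain (t, a, b, y, z) -> w t a b y z <= W }.

Definition weight_symmetric (R : realType) (w : R -> R -> R -> R -> R -> R)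
    (x : R -> R -> R) : Prop :=
  forall t a b, 0 <= t -> 0 <= a <= 1 -> 0 <= b <= 1 ->
    w t a b (x t a) (x t b) = w t b a (x t b) (x t a).

Definition weight_Gamma (R : realType) (r Delta : R)
    (w : R -> R -> R -> R -> R -> R) (x : R -> R -> R) : Prop :=
  forall t a b, 0 <= t -> 0 <= a <= 1 -> 0 <= b <= 1 ->
    `|x t a - x t b| <= r -> Delta <= w t a b (x t a) (x t b).

Definition absolutely_continuous_on (R : realType) (l u : R) (f : R -> R) :
    Prop :=
  forall e : R, 0 < e -> exists2 d : R, 0 < d &
    forall (n : nat) (a b : 'I_n -> R),
      (forall i, [/\ l <= a i, a i <= b i & b i <= u]) ->
      trivIset [set: 'I_n] (fun i => `]a i, b i[%classic) ->
      \sum_(i < n) (b i - a i) < d ->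
      \sum_(i < n) `|f (b i) - f (a i)| < e.

Record is_solution (R : realType) (w : R -> R -> R -> R -> R -> R)
    (x : R -> R -> R) : Prop := IsSolution {
  solution_measurable : forall t, 0 <= t ->
    measurable_fun (`[0, 1]%classic : set (lebesgueR R))
      (x t : lebesgueR R -> R);
  solution_ac : forall a, 0 <= a <= 1 -> forall T, 0 <= T ->
    absolutely_continuous_on 0 T (x^~ a);
  solution_eq : forall a, 0 <= a <= 1 ->
    {ae (@completed_lebesgue_measure R), forall t : R, 0 <= t ->
      is_derive t 1 (x^~ a)
        (\int[@completed_lebesgue_measure R]_(b in `[0, 1]%classic)
           (w t a b (x t a) (x t b) * (x t b - x t a)))};
  solution_init : forall a, 0 <= a <= 1 -> 0 <= x 0 a <= 1;
  solution_bounded : forall T, 0 <= T -> exists M, forall t a,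
    0 <= t <= T -> 0 <= a <= 1 -> `|x t a| <= M }.

(* Main.v *)
(* Extend the dynamics to an abstract probability space of agents,
   with X t a in [0, 1] by a maximum principle.  For a test function f,
   symmetry of the weight gives
     d/dt int f(X) = - 1/2 intint K (f' X_a - f' X_b) (X_a - X_b),
   so f(y) = y^2/2 has a finite total dissipation intint K (X_a - X_b)^2, and
   int f(X) converges for every f with Lipschitz derivative, since
   L y^2/2 + f and L y^2/2 - f are both convex.  With bumps for f, each z either
   keeps a positive mass of agents nearby for all large times (a cluster) or has
   a neighbourhood that empties out.  Two clusters closer than r would dissipate
   at a positive rate, so clusters are r-separated.  The mass away from the
   clusters tends to 0, so almost every agent comes back arbitrarily close to
   some cluster; if it also left that cluster infinitely often, it would spend
   an infinite total time in a ring around it, where interaction with the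
   cluster dissipates at a positive rate, and almost every agent has a finite
   total dissipation. *)

(* Convergence of the energy says nothing about one agent: a single agent has mass zero and its path
   need not be monotone. Fubini passes from the global dissipation to that of almost every agent,
   and the exceptional null set has to be fixed before time tends to infinity; this is why
   recurrence is observed at integer times only. Every exchange of integrals requires measurability
   jointly in time and agent, which is not part of the notion of solution. It follows from
   measurability at each time together with a Lipschitz bound in time common to all agents, and that
   bound rests on the maximum principle. The equation holds at almost every time, with exceptional
   times that depend on the agent. The increments of an agent are therefore recovered from its
   velocity through absolute continuity, and the maximum principle is argued agent by agent: a
   supremum over infinitely many agents need not be attained. *)
Require Import Defs.
From HB Require Import structures.
From mathcomp Require Import all_boot all_order all_algebra.
From mathcomp Require Import all_classical all_reals all_analysis.
From mathcomp Require Import measurable_realfun lra ring.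
Import Order.TTheory GRing.Theory Num.Theory.
Import numFieldNormedType.Exports.
Local Open Scope classical_set_scope.
Set Implicit Arguments.
Unset Strict Implicit.
Unset Printing Implicit Defensive.
Local Open Scope ring_scope.

(** * Increments of absolutely continuous functions *)

(* Cousin's lemma, stated for a transitive relation on the endpoints. *)
Lemma interval_induction (R : realType) (P : R -> R -> Prop) (a b : R) :
  a <= b ->
  (forall s m t, a <= s -> s <= m -> m <= t -> t <= b ->
    P s m -> P m t -> P s t) ->
  (forall c, a <= c <= b -> exists2 e, 0 < e & forall s t,
    a <= s -> s <= c -> c <= t -> t <= b -> t - s < e -> P s t) ->
  P a b.
Proof.
move=> ab Ptrans Ploc.
pose S := [set t | a <= t <= b /\ P a t].
have aS : S a.
  split; first by rewrite lexx ab.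
  have [|e e0 He] := Ploc a; first by rewrite lexx ab.
  by apply: He => //; rewrite subrr.
have supS : has_sup S by split; [exists a | exists b => t [/andP[_ ->]]].
have ac : a <= sup S by apply: ub_le_sup => //; case: supS.
have cb : sup S <= b by apply: ge_sup => [|t [/andP[_ ->]]]; [exists a|].
have [|e e0 He] := Ploc (sup S); first by rewrite ac cb.
have e30 : 0 < e / 3 by rewrite divr_gt0.
have [s [/andP[as_ sb] Ps] sc] := sup_adherent e30 supS.
have {}sc : sup S - e / 3 < s by [].
have sleq : s <= sup S.
  by apply: ub_le_sup; [case: supS | split => //; rewrite as_ sb].
(* [s] is less than e / 3 below the supremum and [t] at most e / 3 above it, so locality at the
   supremum joins them. Unless [t] is [b], it lies beyond the supremum. *)
pose t := Num.min b (sup S + e / 3).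
have ct : sup S <= t by rewrite le_min cb lerDl ltW.
have tb : t <= b by rewrite ge_min lexx.
have te : t <= sup S + e / 3 by rewrite ge_min lexx orbT.
have Pt : P a t.
  by apply: (Ptrans a s) => //; [lra | apply: He => //; lra].
have tc : t <= sup S.
  by apply: ub_le_sup; [case: supS | split => //; apply/andP; split; lra].
suff -> : b = t by [].
move: tc; rewrite /t ge_min => /orP[bc|]; last by lra.
by apply/eqP; rewrite eq_le tb andbT le_min lexx; lra.
Qed.

Lemma is_derive_linear_approx (R : realType) (F : R -> R) (c q e : R) :
  is_derive c 1 F q -> 0 < e ->
  exists2 d, 0 < d &
    forall y, `|y - c| < d -> `|F y - F c - q * (y - c)| <= e * `|y - c|.
Proof.
move=> [dF Fq] e0.
have : h^-1 *: (F (h *: 1 + c) - F c) @[h --> 0^'] --> q.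
  by rewrite -Fq; exact: dF.
move=> /cvgrPdist_le/(_ e e0).
rewrite /dnbhs/within/= => -[d /= d0 Hd]; exists d => // y yc.
have [->|yne] := eqVneq y c; first by rewrite !subrr mulr0 subrr normr0 mulr0.
have ync : y - c != 0 by rewrite subr_eq0.
have := Hd (y - c); rewrite /ball/= sub0r normrN => /(_ yc ync).
rewrite /GRing.scale/= mulr1 subrK => H.
have -> : F y - F c - q * (y - c) =
  - ((q - (y - c)^-1 * (F y - F c)) * (y - c)).
  by field.
by rewrite normrN normrM ler_wpM2r.
Qed.

(* Ordered intervals [u, v] inside [s, t] whose interiors lie in U; when U has
   small measure, an absolutely continuous function has a small total increment
   along them. *)
Fixpoint interval_chain (R : realType) (U : set R) (s : R) (l : seq (R * R))
    (t : R) : Prop :=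
  if l is (u, v) :: l' then
    [/\ s <= u, u <= v, `]u, v[ `<=` U & interval_chain U v l' t]
  else s <= t.

Lemma interval_chain_le (R : realType) (U : set R) l (s t : R) :
  interval_chain U s l t -> s <= t.
Proof.
elim: l s => [//|[u v] l IH] s /= [su uv _ /IH vt].
by rewrite (le_trans su)// (le_trans uv).
Qed.

Lemma interval_chain_cat (R : realType) (U : set R) l1 l2 (s m t : R) :
  interval_chain U s l1 m -> interval_chain U m l2 t ->
  interval_chain U s (l1 ++ l2) t.
Proof.
elim: l1 s => [|[u v] l IH] s /=.
  case: l2 => [|[u v] l2] /= sm; first exact: le_trans.
  by move=> [mu ? ? ?]; split => //; exact: le_trans mu.
by move=> [su uv uvU vm] mt; split => //; exact: IH.
Qed.

Lemma interval_chain_nth (R : realType) (U : set R) l (s t : R) (i : nat) :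
  interval_chain U s l t -> (i < size l)%N ->
  [/\ s <= (nth (0, 0) l i).1, (nth (0, 0) l i).1 <= (nth (0, 0) l i).2,
      (nth (0, 0) l i).2 <= t &
      `](nth (0, 0) l i).1, (nth (0, 0) l i).2[ `<=` U].
Proof.
elim: l s i => [//|[u v] l IH] s [|i] /= [su uv uvU vt] il.
  by split => //; exact: interval_chain_le vt.
have [vi ? ? ?] := IH _ _ vt il; split => //.
by rewrite (le_trans su)// (le_trans uv).
Qed.

Lemma interval_chain_lt (R : realType) (U : set R) l (s t : R) (i j : nat) :
  interval_chain U s l t -> (i < j < size l)%N ->
  (nth (0, 0) l i).2 <= (nth (0, 0) l j).1.
Proof.
elim: l s i j => [s i j _|[u v] l IH s [|i] [|j]]; rewrite ?ltn0 ?andbF//=.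
  by move=> [su uv uvU vt] jl; have [] := interval_chain_nth vt jl.
by move=> [su uv uvU vt] ij; exact: IH vt ij.
Qed.

Lemma interval_chain_trivIset (R : realType) (U : set R) l (s t : R) :
  interval_chain U s l t ->
  trivIset [set: 'I_(size l)]
    (fun i => `](nth (0, 0) l i).1, (nth (0, 0) l i).2[%classic).
Proof.
move=> chn; apply/trivIsetP => /= i j _ _ ij.
wlog: i j ij / (i < j)%N.
  move=> H; have := ij; rewrite neq_ltn => /orP[|] h; first exact: H.
  by rewrite setIC; apply: H => //; rewrite eq_sym.
move=> ltij; rewrite -subset0 => y [] /=; rewrite !in_itv/= => /andP[_ yi].
move=> /andP[jy _]; have := @interval_chain_lt _ _ _ _ _ i j chn.
rewrite ltij ltn_ord => /(_ isT); lra.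
Qed.

Lemma interval_chain_length (R : realType) (U : set R) l (s t : R) :
  measurable U -> interval_chain U s l t ->
  ((\sum_(i < size l) ((nth (0, 0) l i).2 - (nth (0, 0) l i).1))%:E <=
    lebesgue_measure U)%E.
Proof.
move=> mU chn.
rewrite -sumEFin.
under eq_bigr => i _.
  rewrite (_ : (_ - _)%:E = lebesgue_measure
    (`](nth (0, 0) l i).1, (nth (0, 0) l i).2[%classic : set R)).
    over.
  have [_ uv _ _] := interval_chain_nth chn (ltn_ord i).
  rewrite lebesgue_measure_itv/= lte_fin lt_neqAle uv andbT.
  by case: eqVneq => [->|//]; rewrite subrr.
rewrite -measure_bigsetU_ord//; last exact: interval_chain_trivIset chn.
apply: le_measure; rewrite ?inE//; first exact: bigsetU_measurable.
elim/big_ind: _ => // [A B AU BU|i _]; first by rewrite subUset.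
by have [_ _ _] := interval_chain_nth chn (ltn_ord i).
Qed.

Lemma ae_imply d (T : measurableType d) (R : realType)
    (mu : {measure set T -> \bar R}) (P Q : T -> Prop) :
  {ae mu, forall x, P x} -> (forall x, P x -> Q x) -> {ae mu, forall x, Q x}.
Proof.
by move=> [N [mN N0 NP]] PQ; exists N; split => // x nQ; apply: NP => Px;
  apply: nQ; exact: PQ.
Qed.

Lemma ae_and d (T : measurableType d) (R : realType)
    (mu : {measure set T -> \bar R}) (P Q : T -> Prop) :
  {ae mu, forall x, P x} -> {ae mu, forall x, Q x} ->
  {ae mu, forall x, P x /\ Q x}.
Proof.
move=> aeP aeQ; apply: (negligibleS _ (negligibleU aeP aeQ)) => x /= nPQ.
by have [Px|] := pselect (P x); [right => Qx; exact: nPQ | left].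
Qed.

(* The exceptional null set is covered by an open set of small measure, on which
   the increments of F are small by absolute continuity. *)
Lemma ac_le_derive (R : realType) (F q : R -> R) (a b K : R) :
  a <= b -> absolutely_continuous_on a b F ->
  {ae (@lebesgue_measure R), forall t, a < t < b ->
    is_derive t 1 F (q t) /\ q t <= K} ->
  F b - F a <= K * (b - a).
Proof.
move=> ab acF [N [mN N0 NF]].
apply/ler_addgt0Pr => e e0.
have e40 : 0 < e / 4 by rewrite divr_gt0.
have [d d0 acd] := acF _ e40.
pose e1 := e / 2 / (b - a + 1).
have ba1 : 0 < b - a + 1 by lra.
have e10 : 0 < e1 by rewrite !divr_gt0.
pose C := `|K + e1|.
have C0 : 0 <= C by exact: normr_ge0.
have C10 : 0 < C + 1 by lra.
(* The first bound makes the chain shorter than [d], so that [F] varies by less than e / 4 along it;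
   the second keeps [C] times its length within e / 4. The slack [e1] in the slope costs the
   remaining e / 2. *)
pose d1 := Num.min (d / 2) (e / 4 / (C + 1)).
have d10 : 0 < d1 by rewrite lt_min !divr_gt0.
(* The endpoints join the exceptional set because the derivative is controlled only strictly between
   them. *)
pose E := N `|` ([set a] `|` [set b]).
have E0 : ((wlength (@idfun R))^* E)%mu = 0%E.
  apply/negligible_outer_measure; apply: negligibleU.
    by exists N; split.
  by apply: negligibleU; [exists [set a] | exists [set b]]; split => //;
    exact: lebesgue_measure_set1.
have [U [oU EU]] := outer_measure_open_le E d10.
rewrite E0 add0e => Ud.
(* On an interval of the chain the slope is unknown and [K + e1] may be negative; the term in [C]
   offsets it there. *)
pose P s t := exists2 l, interval_chain U s l t &
  F t - F s <= (K + e1) * (t - s) +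
    \sum_(p <- l) (`|F p.2 - F p.1| + C * (p.2 - p.1)).
have [l chn Fl] : P a b.
  apply: interval_induction => //.
    move=> s m t _ _ _ _ [l1 c1 F1] [l2 c2 F2]; exists (l1 ++ l2).
      exact: interval_chain_cat c1 c2.
    rewrite big_cat/=; apply: le_trans (_ : _ <= (F t - F m) + (F m - F s)) _.
      by lra.
    by apply: le_trans (lerD F2 F1) _; lra.
  move=> c /andP[ac cb]; have [cU|cU] := pselect (U c).
    have /nbhs_ballP[r /= r0 rU] := open_nbhs_nbhs (conj oU cU).
    exists r => // s t as_ sc ct tb tsr; exists [:: (s, t)] => /=.
      split => //; first exact: le_trans ct.
      move=> y /=; rewrite in_itv/= => /andP[sy yt]; apply: rU.
      by rewrite /ball/= ltr_norml; apply/andP; split; lra.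
    rewrite big_seq1/= addrCA -mulrDl.
    have := ler_norm (F t - F s).
    suff : 0 <= (K + e1 + C) * (t - s) by lra.
    have := ler_norm (- (K + e1)); rewrite normrN -/C => ?.
    by rewrite mulr_ge0//; lra.
  have cac : a < c.
    rewrite lt_neqAle ac andbT; apply/eqP => eac.
    by apply: cU; apply: EU; right; left.
  have ccb : c < b.
    rewrite lt_neqAle cb andbT; apply/eqP => ecb.
    by apply: cU; apply: EU; right; right.
  have [dF qK] : is_derive c 1 F (q c) /\ q c <= K.
    have [//|h] := pselect (is_derive c 1 F (q c) /\ q c <= K).
    case: cU; apply: EU; left; apply: NF => /= H.
    by apply: h; apply: H; rewrite cac ccb.
  have [r r0 Hr] := is_derive_linear_approx dF e10.
  exists r => // s t as_ sc ct tb tsr; exists [::] => /=.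
    exact: le_trans ct.
  rewrite big_nil addr0.
  have : `|t - c| < r by rewrite ger0_norm; lra.
  move=> /Hr; rewrite (@ger0_norm _ (t - c)); last by lra.
  have : `|s - c| < r by rewrite ler0_norm; lra.
  move=> /Hr; rewrite (@ler0_norm _ (s - c)); last by lra.
  move=> /ler_normlP[hs1 hs2] /ler_normlP[ht1 ht2].
  have : 0 <= (K - q c) * (t - s) by rewrite mulr_ge0; lra.
  lra.
have le := interval_chain_length (open_measurable oU) chn.
have {}le := le_trans le Ud.
rewrite lee_fin in le.
have {acd} acd := acd (size l) (fun i => (nth (0, 0) l i).1)
  (fun i => (nth (0, 0) l i).2).
have : \sum_(i < size l)
    `|F (nth (0, 0) l i).2 - F (nth (0, 0) l i).1| < e / 4.
  apply: acd.
  - by move=> i; have [] := interval_chain_nth chn (ltn_ord i).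
  - exact: interval_chain_trivIset chn.
  - apply: le_lt_trans le _; rewrite gt_min; apply/orP; left; lra.
move: Fl; rewrite big_split/= -mulr_sumr !(big_nth (0, 0)) !big_mkord.
have : C * (\sum_(i < size l) ((nth (0, 0) l i).2 - (nth (0, 0) l i).1))
   <= e / 4.
  apply: le_trans (ler_wpM2l C0 le) _.
  apply: le_trans (_ : C * (e / 4 / (C + 1)) <= _).
    by rewrite ler_wpM2l// ge_min lexx orbT.
  rewrite mulrCA ger_pMr// ler_pdivrMr//; lra.
have : e1 * (b - a) <= e / 2.
  rewrite /e1 -mulrA ger_pMr; last by lra.
  rewrite mulrC ler_pdivrMr//; lra.
lra.
Qed.

Lemma lipschitz_ac (R : realType) (F : R -> R) (a b L : R) :
  (forall s t, a <= s -> s <= t -> t <= b -> `|F t - F s| <= L * (t - s)) ->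
  absolutely_continuous_on a b F.
Proof.
move=> lipF e e0; pose L1 := `|L| + 1.
have L10 : 0 < L1 by rewrite ltr_wpDl.
exists (e / L1); first by rewrite divr_gt0.
move=> n u v uv _ le.
apply: le_lt_trans (_ : L1 * \sum_(i < n) (v i - u i) < _); last first.
  by rewrite mulrC -ltr_pdivlMr.
rewrite mulr_sumr; apply: ler_sum => i _; have [au uvi vb] := uv i.
apply: le_trans (lipF _ _ au uvi vb) _; rewrite ler_wpM2r ?subr_ge0//.
by rewrite /L1; have := ler_norm L; lra.
Qed.

Lemma ac_lipschitz (R : realType) (F q : R -> R) (a b K : R) :
  absolutely_continuous_on a b F ->
  {ae (@lebesgue_measure R), forall t, a < t < b ->
    is_derive t 1 F (q t) /\ `|q t| <= K} ->
  forall s t, a <= s -> s <= t -> t <= b -> `|F t - F s| <= K * (t - s).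
Proof.
move=> acF dF s t as_ st tb.
have subac G : absolutely_continuous_on a b G ->
    absolutely_continuous_on s t G.
  move=> acG e e0; have [d d0 Hd] := acG e e0; exists d => // n u v uv.
  by apply: Hd => i; have [? ? ?] := uv i; split; lra.
rewrite ler_norml; apply/andP; split; last first.
  apply: (@ac_le_derive _ F q) => //; first exact: subac.
  apply: (ae_imply dF) => u H /andP[su ut].
  have [|dFu qK] := H; first by apply/andP; split; lra.
  by split => //; apply: le_trans qK; exact: ler_norm.
suff : (- F t) - (- F s) <= K * (t - s) by lra.
apply: (@ac_le_derive _ (- F) (- q)) => //.
  apply: subac => e /acF[d d0 Hd]; exists d => // n u v uv triv len.
  apply: le_lt_trans (Hd n u v uv triv len); apply: ler_sum => i _.
  suff -> : (- F) (v i) - (- F) (u i) = - (F (v i) - F (u i)).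
    by rewrite normrN.
  by rewrite opprB addrC [LHS]/(- - F (u i) - F (v i)) opprK.
apply: (ae_imply dF) => u H /andP[su ut].
have [|dFu qK] := H; first by apply/andP; split; lra.
by split; [exact: is_deriveN | apply: le_trans qK; rewrite -normrN ler_norm].
Qed.

(** * Bounded integrands, Fubini, and the fundamental theorem of calculus *)

Lemma bounded_integrable d (T : measurableType d) (R : realType)
    (mu : {measure set T -> \bar R}) (D : set T) (f : T -> R) (M : R) :
  measurable D -> (mu D < +oo)%E -> measurable_fun D f ->
  (forall x, D x -> `|f x| <= M) -> mu.-integrable D (EFin \o f).
Proof.
move=> mD muD mf fM; apply: measurable_bounded_integrable => //.
exists M; split; first exact: num_real.
by move=> y My x Dx; exact: le_trans (fM x Dx) (ltW My).
Qed.

Lemma norm_Rintegral_le d (T : measurableType d) (R : realType)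
    (mu : {measure set T -> \bar R}) (D : set T) (f : T -> R) (M : R) :
  measurable D -> (mu D < +oo)%E -> measurable_fun D f ->
  (forall x, D x -> `|f x| <= M) ->
  `|\int[mu]_(x in D) f x| <= M * fine (mu D).
Proof.
move=> mD muD mf fM; have intf := bounded_integrable mD muD mf fM.
apply: le_trans (le_normr_Rintegral mD intf) _.
rewrite -Rintegral_cst//; apply: le_Rintegral => //.
- exact: integrable_norm.
- by apply: (@bounded_integrable _ _ _ _ _ _ `|M|) => //; exact: measurable_cst.
Qed.

(** Tonelli's measurability statement concerns nonnegative functions on the whole space: [f] is
    shifted by its bound and multiplied by the indicator of [D2], and the integral of the shift is
    subtracted at the end. *)
Lemma measurable_Rintegral d1 d2 (T1 : measurableType d1)
    (T2 : measurableType d2) (R : realType)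
    (m2 : {sigma_finite_measure set T2 -> \bar R})
    (D2 : set T2) (f : T1 * T2 -> R) (M : R) :
  measurable D2 -> (m2 D2 < +oo)%E ->
  measurable_fun setT f -> (forall p, `|f p| <= M) ->
  measurable_fun setT (fun x => \int[m2]_(y in D2) f (x, y)).
Proof.
move=> mD2 m2D mf fM.
pose g p := (((f p + M) * \1_D2 p.2)%:E : \bar R).
have g0 p : (0 <= g p)%E.
  rewrite lee_fin mulr_ge0//.
  by have := fM p; rewrite ler_norml => /andP[+ _]; lra.
have mg : measurable_fun setT g.
  apply/measurable_EFinP/measurable_funM; first exact: measurable_funD.
  by apply: measurableT_comp => //; exact: measurable_indic.
rewrite (_ : (fun x => _) =
    (fun x => fine (\int[m2]_y g (x, y))%E - M * fine (m2 D2))).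
  apply: measurable_funB => //; apply: measurableT_comp => //.
  exact: measurable_fun_fubini_tonelli_F.
apply/funext => x.
have mfx : measurable_fun D2 (fun y => f (x, y)).
  by apply: measurable_funTS; exact: measurableT_comp.
have intM : m2.-integrable D2 (EFin \o (fun=> M)).
  apply: (@bounded_integrable _ _ _ _ _ _ `|M|) => //.
rewrite -[RHS]addr0 -(Rintegral_cst m2 mD2 M).
rewrite (_ : fine _ = \int[m2]_(y in D2) (f (x, y) + M)).
  rewrite RintegralD//; first by rewrite addr0 addrK.
  exact: (@bounded_integrable _ _ _ _ _ (fun y => f (x, y)) M).
rewrite Rintegral_mkcond; congr fine; apply: eq_integral => y _.
by rewrite /g patchE/= indicE; case: (y \in D2); rewrite ?(mulr1, mulr0).
Qed.

Lemma Rintegral_fubini d1 d2 (T1 : measurableType d1) (T2 : measurableType d2)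
    (R : realType) (m1 : {sigma_finite_measure set T1 -> \bar R})
    (m2 : {sigma_finite_measure set T2 -> \bar R})
    (D1 : set T1) (D2 : set T2) (f : T1 * T2 -> R) (M : R) :
  measurable D1 -> measurable D2 -> (m1 D1 < +oo)%E -> (m2 D2 < +oo)%E ->
  measurable_fun setT f -> (forall p, `|f p| <= M) ->
  \int[m1]_(x in D1) (\int[m2]_(y in D2) f (x, y)) =
  \int[m2]_(y in D2) (\int[m1]_(x in D1) f (x, y)).
Proof.
move=> mD1 mD2 m1D m2D mf fM.
have mD : measurable (D1 `*` D2) by exact: measurableX.
(* Cut off outside a rectangle of finite product measure, the bounded [f] is integrable on the whole
   product. *)
pose g := f \_ (D1 `*` D2).
have intg : (m1 \x m2)%E.-integrable setT (EFin \o g).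
  rewrite /g -restrict_EFin; apply/(integrable_mkcond _ mD).1.
  apply: (@bounded_integrable _ _ _ _ _ f M) => //; last first.
    exact: measurable_funTS.
  by rewrite /= product_measure1E// lte_mul_pinfty// ge0_fin_numE.
have gE x y : g (x, y) = \1_D1 x * \1_D2 y * f (x, y).
  by rewrite /g patchE in_setX/= !indicE; case: (x \in D1); case: (y \in D2);
    rewrite ?(mul0r, mul1r).
have int1 y : m1.-integrable D1 (EFin \o (fun x => f (x, y))).
  apply: (@bounded_integrable _ _ _ _ _ _ M) => //.
  by apply: measurable_funTS; exact: measurableT_comp.
have int2 x : m2.-integrable D2 (EFin \o (fun y => f (x, y))).
  apply: (@bounded_integrable _ _ _ _ _ _ M) => //.
  by apply: measurable_funTS; exact: measurableT_comp.
have g2 x : (\int[m2]_y (g (x, y))%:E)%E =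
    ((fun x => \int[m2]_(y in D2) f (x, y)) \_ D1 x)%:E.
  rewrite patchE; case: ifPn => xD; last first.
    rewrite integral0_eq// => y _; rewrite gE indicE (negbTE xD).
    by rewrite !mul0r.
  rewrite /Rintegral fineK; last exact: (integrable_fin_num mD2 (int2 x)).
  rewrite [RHS]integral_mkcond; apply: eq_integral => y _.
  rewrite gE patchE !indicE xD mul1r; case: (y \in D2);
    by rewrite ?(mul0r, mul1r).
have g1 y : (\int[m1]_x (g (x, y))%:E)%E =
    ((fun y => \int[m1]_(x in D1) f (x, y)) \_ D2 y)%:E.
  rewrite patchE; case: ifPn => yD; last first.
    rewrite integral0_eq// => x _; rewrite gE !indicE (negbTE yD).
    by rewrite mulr0 mul0r.
  rewrite /Rintegral fineK; last exact: (integrable_fin_num mD1 (int1 y)).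
  rewrite [RHS]integral_mkcond; apply: eq_integral => x _.
  rewrite gE patchE !indicE yD mulr1; case: (x \in D1);
    by rewrite ?(mul0r, mul1r).
have := Fubini intg.
under eq_integral do rewrite /= g2.
under [X in _ = X -> _]eq_integral do rewrite /= g1.
by move=> E; rewrite [LHS]Rintegral_mkcond [RHS]Rintegral_mkcond /Rintegral E.
Qed.

Lemma lebesgue_segment_lty (R : realType) (s t : R) :
  (@lebesgue_measure R `[s, t] < +oo)%E.
Proof. exact/compact_finite_measure/segment_compact. Qed.

Lemma lebesgue_measure_itvoc (R : realType) (s t : R) :
  s <= t -> @lebesgue_measure R `]s, t] = (t - s)%:E.
Proof.
move=> st; rewrite lebesgue_measure_itv/= lte_fin; case: ltP => // ts.
by rewrite (le_anti (_ : s <= t <= s)) ?st ?ts// subrr.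
Qed.

(** The indefinite integral [G] of [q] is Lipschitz and has derivative [q] almost everywhere by
    Lebesgue differentiation. So F - G is Lipschitz with derivative zero almost everywhere, hence
    constant. *)
Lemma Rintegral_derive (R : realType) (F q : R -> R) (a b L M : R) :
  a <= b ->
  (forall s t, a <= s -> s <= t -> t <= b -> `|F t - F s| <= L * (t - s)) ->
  measurable_fun setT q -> (forall t, `|q t| <= M) ->
  {ae (@lebesgue_measure R), forall t, a < t < b -> is_derive t 1 F (q t)} ->
  \int[lebesgue_measure]_(t in `[a, b]) q t = F b - F a.
Proof.
move=> ab lipF mq qM dF.
have intq s t : (@lebesgue_measure R).-integrable `[s, t] (EFin \o q).
  apply: (@bounded_integrable _ _ _ _ _ _ M) => //.
    exact: lebesgue_segment_lty.
  exact: measurable_funTS.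
pose G y := \int[lebesgue_measure]_(t in `[a, y]) q t.
have lipG s t : a <= s -> s <= t -> t <= b -> `|G t - G s| <= M * (t - s).
  move=> as_ st tb.
  rewrite /G (Rintegral_itvB (x := s) (intq a t)) ?bnd_simp//.
  apply: le_trans (norm_Rintegral_le (M := M) _ _ _ _) _ => //.
  - by rewrite [ltLHS](lebesgue_measure_itvoc st) ltry.
  - exact: measurable_funTS.
  - by rewrite [X in fine X](lebesgue_measure_itvoc st).
have dG : {ae (@lebesgue_measure R), forall t, a < t < b ->
    is_derive t 1 G (q t)}.
  have locq : locally_integrable [set: R] q.
    split => //; first exact: openT.
    move=> K _ cK; have mK := compact_measurable cK.
    have iK : (@lebesgue_measure R).-integrable K (EFin \o (fun t => `|q t|)).
      apply: (@bounded_integrable _ _ _ _ _ _ M) => //.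
      - exact: compact_finite_measure.
      - by apply: measurable_funTS; exact: measurableT_comp.
      - by move=> t _ /=; rewrite normr_id.
    rewrite -ge0_fin_numE; last exact: integral_ge0.
    by apply: integrable_fin_num iK; exact: mK.
  have := @FTC1 R q (BLeft a) (intq a) locq.
  move=> /ae_imply; apply => t dGt /andP[at_ tb].
  have [|dGt1 dGt2] := dGt; first by rewrite /= lte_fin.
  by apply: DeriveDef; [exact: dGt1|rewrite -derive1E].
have lipH s t : a <= s -> s <= t -> t <= b ->
    `|(F t - G t) - (F s - G s)| <= (L + M) * (t - s).
  move=> as_ st tb; rewrite mulrDl.
  apply: le_trans (lerD (lipF _ _ as_ st tb) (lipG _ _ as_ st tb)).
  have -> : F t - G t - (F s - G s) = (F t - F s) - (G t - G s) by ring.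
  exact: ler_normB.
have acH := lipschitz_ac lipH.
have : `|(F b - G b) - (F a - G a)| <= 0 * (b - a).
  apply: (ac_lipschitz (q := cst 0) acH) => //.
  apply: (ae_imply (ae_and dF dG)) => t [dFt dGt] tab; split.
    have := is_deriveB (dFt tab) (dGt tab).
    by rewrite subrr.
  by rewrite normr0.
have -> : G a = 0 by rewrite /G set_itv1 Rintegral_set1.
rewrite mul0r normr_le0 subr0 => /eqP.
by rewrite -/(G b); lra.
Qed.

(** * Averaging flows and the variation of observables *)

Definition drift d (A : measurableType d) (R : realType)
    (mu : {measure set A -> \bar R}) (D : set A) (K : R -> A -> A -> R)
    (X : R -> A -> R) t a : R :=
  \int[mu]_(b in D) (K t a b * (X t b - X t a)).

(** [K] stands for the weight evaluated along the solution, where it is symmetric in the two agents.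
    The bounds and the Lipschitz condition hold at all real times and for all agents, and
    measurability is global; only the integrals are confined to [D], and the equation to positive
    times. *)
Record averaging_flow d (A : measurableType d) (R : realType)
    (mu : {measure set A -> \bar R}) (D : set A) (K : R -> A -> A -> R)
    (X : R -> A -> R) (W : R) : Prop := AveragingFlow {
  flow_measurable_domain : measurable D;
  flow_domain_mass : mu D = 1%E;
  flow_measurable :
    measurable_fun setT (fun p : measurableTypeR R * A => X p.1 p.2);
  flow_measurable_rate : measurable_fun setT
    (fun p : measurableTypeR R * A * A => K p.1.1 p.1.2 p.2);
  flow_itv : forall t a, 0 <= X t a <= 1;
  flow_rate_ge0 : forall t a b, 0 <= K t a b;
  flow_rate_le : forall t a b, K t a b <= W;
  flow_rate_sym : forall t a b, K t a b = K t b a;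
  flow_lipschitz : forall a s t, s <= t -> `|X t a - X s a| <= W * (t - s);
  flow_derive : forall a, {ae (@lebesgue_measure R), forall t : R, 0 < t ->
    is_derive t 1 (X^~ a) (drift mu D K X t a)} }.

Section averaging_flow.
Context d (A : measurableType d) (R : realType)
  (mu : {sigma_finite_measure set A -> \bar R}) (D : set A)
  (K : R -> A -> A -> R) (X : R -> A -> R) (W : R).
Hypothesis flow : averaging_flow mu D K X W.

Let mD : measurable D := flow_measurable_domain flow.
Let muD : mu D = 1%E := flow_domain_mass flow.
Let mX := flow_measurable flow.
Let mK := flow_measurable_rate flow.
Let X01 := flow_itv flow.
Let K0 := flow_rate_ge0 flow.
Let KW := flow_rate_le flow.
Let Ksym := flow_rate_sym flow.
Let Xlip := flow_lipschitz flow.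
Let dX := flow_derive flow.

Local Notation drift := (drift mu D K X).

Let muD_lty : (mu D < +oo)%E. Proof. by rewrite muD ltry. Qed.

Lemma flow_measurable_comp d' (T : measurableType d')
    (u : T -> measurableTypeR R) (v : T -> A) :
  measurable_fun setT u -> measurable_fun setT v ->
  measurable_fun setT (fun p => X (u p) (v p)).
Proof.
move=> mu_ mv; have := measurable_fun_pair mu_ mv.
exact: (@measurableT_comp _ _ _ _ _ _ _ _ (fun p => (u p, v p)) mX).
Qed.

Lemma flow_measurable_rate_comp d' (T : measurableType d')
    (u : T -> measurableTypeR R) (v w : T -> A) :
  measurable_fun setT u -> measurable_fun setT v -> measurable_fun setT w ->
  measurable_fun setT (fun p => K (u p) (v p) (w p)).
Proof.
move=> mu_ mv mw.
have := measurable_fun_pair (measurable_fun_pair mu_ mv) mw.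
exact: (@measurableT_comp _ _ _ _ _ _ _ _ (fun p => ((u p, v p), w p)) mK).
Qed.

Let mXt t : measurable_fun setT (X t).
Proof. exact: flow_measurable_comp. Qed.

Lemma norm_integral_le (f : A -> R) M :
  measurable_fun setT f -> (forall a, `|f a| <= M) ->
  `|\int[mu]_(a in D) f a| <= M.
Proof.
move=> mf fM.
apply: le_trans (norm_Rintegral_le (M := M) mD muD_lty _ _) _ => //.
  exact: measurable_funTS.
by rewrite [X in fine X]muD mulr1.
Qed.

Lemma flow_bounded_integrable (f : A -> R) M :
  measurable_fun setT f -> (forall a, `|f a| <= M) ->
  mu.-integrable D (EFin \o f).
Proof.
move=> mf fM; apply: (@bounded_integrable _ _ _ _ _ _ M) => //.
exact: measurable_funTS.
Qed.

(** Here and below, the digit in the name counts the agents integrated out. *)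
Lemma measurable_integral1 (h : measurableTypeR R -> A -> A -> R) M :
  measurable_fun setT
    (fun p : measurableTypeR R * A * A => h p.1.1 p.1.2 p.2) ->
  (forall t a b, `|h t a b| <= M) ->
  measurable_fun setT
    (fun p : measurableTypeR R * A => \int[mu]_(b in D) h p.1 p.2 b).
Proof.
by move=> mh hM; apply: (measurable_Rintegral (M := M)
  (f := fun p : measurableTypeR R * A * A => h p.1.1 p.1.2 p.2)).
Qed.

Lemma integral1_le (h : measurableTypeR R -> A -> A -> R) M :
  measurable_fun setT
    (fun p : measurableTypeR R * A * A => h p.1.1 p.1.2 p.2) ->
  (forall t a b, `|h t a b| <= M) ->
  forall t a, `|\int[mu]_(b in D) h t a b| <= M.
Proof.
move=> mh hM t a; apply: norm_integral_le; last exact: hM.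
exact: (measurable_fun_pair2 (t, a) mh).
Qed.

Lemma measurable_integral2 (h : measurableTypeR R -> A -> A -> R) M :
  measurable_fun setT
    (fun p : measurableTypeR R * A * A => h p.1.1 p.1.2 p.2) ->
  (forall t a b, `|h t a b| <= M) ->
  measurable_fun setT (fun t : measurableTypeR R =>
    \int[mu]_(a in D) \int[mu]_(b in D) h t a b).
Proof.
move=> mh hM; apply: (measurable_Rintegral (M := M)
  (f := fun p : measurableTypeR R * A => \int[mu]_(b in D) h p.1 p.2 b)) => //.
  exact: measurable_integral1 mh hM.
by move=> p; exact: integral1_le.
Qed.

Lemma integral2_le (h : measurableTypeR R -> A -> A -> R) M :
  measurable_fun setT
    (fun p : measurableTypeR R * A * A => h p.1.1 p.1.2 p.2) ->
  (forall t a b, `|h t a b| <= M) ->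
  forall t, `|\int[mu]_(a in D) \int[mu]_(b in D) h t a b| <= M.
Proof.
move=> mh hM t; apply: norm_integral_le; last by move=> a; exact: integral1_le.
exact: (measurable_fun_pair2 t (measurable_integral1 mh hM)).
Qed.

Lemma integrable_integral2 (h : measurableTypeR R -> A -> A -> R) M S T :
  measurable_fun setT
    (fun p : measurableTypeR R * A * A => h p.1.1 p.1.2 p.2) ->
  (forall t a b, `|h t a b| <= M) ->
  (@lebesgue_measure R).-integrable `[S, T] (EFin \o
    (fun t => \int[mu]_(a in D) \int[mu]_(b in D) h t a b)).
Proof.
move=> mh hM; apply: (@bounded_integrable _ _ _ _ _ _ M) => //.
- exact: lebesgue_segment_lty.
- by apply: measurable_funTS; exact: measurable_integral2 mh hM.
- by move=> t _; exact: integral2_le.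
Qed.

Let Xdist t a b : `|X t b - X t a| <= 1.
Proof.
have /andP[? ?] := X01 t a; have /andP[? ?] := X01 t b.
by rewrite ler_norml; apply/andP; split; lra.
Qed.

Let W0 (a : A) : 0 <= W. Proof. exact: le_trans (K0 0 a a) (KW 0 a a). Qed.

Let pull_le t a b : `|K t a b * (X t b - X t a)| <= W.
Proof.
rewrite normrM ger0_norm//.
by apply: le_trans (ler_pM _ _ (KW t a b) (Xdist t a b)) _ => //; rewrite mulr1.
Qed.

Lemma measurable_drift :
  measurable_fun setT (fun p : measurableTypeR R * A => drift p.1 p.2).
Proof.
pose f (p : measurableTypeR R * A * A) :=
  K p.1.1 p.1.2 p.2 * (X p.1.1 p.2 - X p.1.1 p.1.2).
apply: (@measurable_Rintegral _ _ _ _ _ mu D f W) => //; last first.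
  by move=> p; exact: pull_le.
apply: measurable_funM.
  by apply: flow_measurable_rate_comp => //; exact: measurableT_comp.
by apply: measurable_funB; apply: flow_measurable_comp => //;
  exact: measurableT_comp.
Qed.

Let mdrift_comp d' (T : measurableType d') (u : T -> measurableTypeR R)
    (v : T -> A) :
  measurable_fun setT u -> measurable_fun setT v ->
  measurable_fun setT (fun p => drift (u p) (v p)).
Proof.
move=> mu_ mv; have := measurable_fun_pair mu_ mv.
exact: (@measurableT_comp _ _ _ _ _ _ _ _ (fun p => (u p, v p))
  measurable_drift).
Qed.

Lemma drift_le t a : `|drift t a| <= W.
Proof.
apply: norm_integral_le => //; apply: measurable_funM.
  exact: flow_measurable_rate_comp.
exact: measurable_funB.
Qed.

Section observable.
Variables (f f' : R -> R) (L : R).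
Hypothesis df : forall y : R, is_derive y 1 f (f' y).
Hypothesis mf' : measurable_fun setT f'.
Hypothesis Lf' : forall u v, 0 <= u <= 1 -> 0 <= v <= 1 ->
  `|f' u - f' v| <= L * `|u - v|.

(** A bound of [f'] on [0, 1], hence a Lipschitz constant of [f] there. *)
Let M := `|f' 0| + L.

Let L_ge0 : 0 <= L.
Proof.
have := Lf' (u := 0) (v := 1).
rewrite !lexx !ler01 sub0r normrN normr1 mulr1 => /(_ isT isT).
exact: le_trans.
Qed.

Let f'_le u : 0 <= u <= 1 -> `|f' u| <= M.
Proof.
move=> u01; have u0 : 0 <= (0 : R) <= 1 by rewrite lexx ler01.
have := Lf' u01 u0; rewrite subr0 => f'u.
have : `|f' u| <= `|f' u - f' 0| + `|f' 0|.
  by apply: le_trans (ler_normD _ _); rewrite subrK.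
have /andP[uge0 ule1] := u01.
have : L * `|u| <= L by rewrite ger0_norm// ler_piMr.
rewrite /M; lra.
Qed.

Let f_continuous : continuous f.
Proof.
by move=> y; apply/differentiable_continuous/derivable1_diffP; case: (df y).
Qed.

Let f_lip u v : 0 <= u -> u <= v -> v <= 1 -> `|f v - f u| <= M * (v - u).
Proof.
move=> u0 uv v1.
have cf : {within `[u, v], continuous f} by exact: continuous_subspaceT.
have [c] := MVT_segment uv (fun y _ => df y) cf.
rewrite in_itv/= => /andP[uc cv] ->.
rewrite normrM (@ger0_norm _ (v - u)) ?subr_ge0// ler_wpM2r ?subr_ge0//.
by apply: f'_le; apply/andP; split; lra.
Qed.

Let M0 : 0 <= M. Proof. by rewrite addr_ge0. Qed.

Let f_lip' u v : 0 <= u <= 1 -> 0 <= v <= 1 -> `|f v - f u| <= M * `|v - u|.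
Proof.
move=> /andP[u0 u1] /andP[v0 v1]; have [uv|/ltW vu] := leP u v.
  by rewrite (@ger0_norm _ (v - u)) ?subr_ge0//; exact: f_lip.
rewrite distrC (distrC v u) (@ger0_norm _ (u - v)) ?subr_ge0//; exact: f_lip.
Qed.

Let f_flow_integral S T a : 0 <= S -> S <= T ->
  \int[lebesgue_measure]_(t in `[S, T]) (f' (X t a) * drift t a) =
  f (X T a) - f (X S a).
Proof.
move=> S0 ST.
apply: (@Rintegral_derive R (fun t => f (X t a))
    (fun t => f' (X t a) * drift t a) S T (M * W) (M * W)) => //.
- move=> s t _ st _; apply: le_trans (f_lip' (X01 s a) (X01 t a)) _.
  by rewrite -mulrA ler_wpM2l// Xlip.
- have mid := @measurable_id _ (measurableTypeR R) setT.
  exact: (measurable_funM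
    (measurableT_comp mf' (flow_measurable_comp mid (measurable_cst a)))
    (mdrift_comp mid (measurable_cst a))).
- by move=> t; rewrite normrM ler_pM// ?f'_le// drift_le.
- apply: (ae_imply (dX a)) => t dXt /andP[St tT].
  have t0 : 0 < t by exact: le_lt_trans St.
  have dft := df (X t a); have {}dXt := dXt t0.
  exact: (is_derive1_comp (f := f) (g := X^~ a)).
Qed.

Let Phi t := \int[mu]_(a in D) f (X t a).

(* Exchanging the roles of a and b, by the symmetry of K, and averaging. *)
Lemma observable_variation S T : 0 <= S -> S <= T ->
  Phi T - Phi S = - 2^-1 * \int[lebesgue_measure]_(t in `[S, T])
    \int[mu]_(a in D) \int[mu]_(b in D)
      (K t a b * (f' (X t a) - f' (X t b)) * (X t a - X t b)).
Proof.
move=> S0 ST.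
have mf : measurable_fun setT f by exact: continuous_measurable_fun.
have mfX t : measurable_fun setT (fun a => f (X t a)).
  exact: measurableT_comp.
have fb y : 0 <= y <= 1 -> `|f y| <= `|f 0| + M.
  move=> y01; have u0 : 0 <= (0 : R) <= 1 by rewrite lexx ler01.
  have := f_lip' u0 y01; rewrite subr0 => fy.
  have : `|f y| <= `|f y - f 0| + `|f 0|.
    by apply: le_trans (ler_normD _ _); rewrite subrK.
  have /andP[yge0 yle1] := y01.
  have : M * `|y| <= M by rewrite ger0_norm// ler_piMr.
  lra.
have iPhi t : mu.-integrable D (EFin \o (fun a => f (X t a))).
  by apply: (flow_bounded_integrable (M := `|f 0| + M)) => // a; exact: fb.
pose q (t : measurableTypeR R) a b :=
  f' (X t a) * (K t a b * (X t b - X t a)).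
have q_le t a b : `|q t a b| <= M * W.
  by rewrite normrM ler_pM// ?f'_le.
have mq_comp d' (U : measurableType d') (u : U -> measurableTypeR R)
    (v w : U -> A) : measurable_fun setT u -> measurable_fun setT v ->
    measurable_fun setT w -> measurable_fun setT (fun p => q (u p) (v p) (w p)).
  move=> mu_ mv mw; apply: measurable_funM.
    by apply: measurableT_comp => //; exact: flow_measurable_comp.
  apply: measurable_funM; first exact: flow_measurable_rate_comp.
  by apply: measurable_funB; exact: flow_measurable_comp.
have qE t a : f' (X t a) * drift t a = \int[mu]_(b in D) q t a b.
  rewrite RintegralZl//; apply: (flow_bounded_integrable (M := W)) => //.
  apply: measurable_funM; first exact: flow_measurable_rate_comp.
  by apply: measurable_funB => //; exact: measurable_cst.
pose G (t : measurableTypeR R) a b :=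
  K t a b * (f' (X t a) - f' (X t b)) * (X t a - X t b).
have mG_comp d' (U : measurableType d') (u : U -> measurableTypeR R)
    (v w : U -> A) : measurable_fun setT u -> measurable_fun setT v ->
    measurable_fun setT w -> measurable_fun setT (fun p => G (u p) (v p) (w p)).
  move=> mu_ mv mw.
  apply: measurable_funM; last first.
    by apply: measurable_funB; exact: flow_measurable_comp.
  apply: measurable_funM; first exact: flow_measurable_rate_comp.
  by apply: measurable_funB; apply: measurableT_comp => //;
    exact: flow_measurable_comp.
have m1 : measurable_fun setT (fun p : measurableTypeR R * A * A => p.1.1).
  exact: measurableT_comp.
have m2 : measurable_fun setT (fun p : measurableTypeR R * A * A => p.1.2).
  exact: measurableT_comp.
have mG : measurable_fun setT
    (fun p : measurableTypeR R * A * A => G p.1.1 p.1.2 p.2).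
  exact: (mG_comp _ _ _ _ _ m1 m2 (@measurable_snd _ _ _ A)).
have mq : measurable_fun setT
    (fun p : measurableTypeR R * A * A => q p.1.1 p.1.2 p.2).
  exact: (mq_comp _ _ _ _ _ m1 m2 (@measurable_snd _ _ _ A)).
have G_le t a b : `|G t a b| <= W * (M + M).
  rewrite -[leRHS]mulr1 !normrM ger0_norm// ler_pM ?mulr_ge0//.
  rewrite ler_pM//; apply: le_trans (ler_normB _ _) _.
  by apply: lerD; exact: f'_le.
rewrite -RintegralB//.
(* Fubini serves twice: here between agents and time, then between the two agents at a fixed
   time. *)
under eq_Rintegral do rewrite -f_flow_integral//.
have /= -> := @Rintegral_fubini _ _ A (measurableTypeR R) R
  mu lebesgue_measure D `[S, T]%classic
  (fun p => f' (X p.2 p.1) * drift p.2 p.1) (M * W) mD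
  (measurable_itv `[S, T]) muD_lty (lebesgue_segment_lty S T) _ _.
- rewrite -RintegralZl//; last exact: integrable_integral2 mG G_le.
  apply: eq_Rintegral => t _.
  under eq_Rintegral do rewrite qE.
  have mqt : measurable_fun setT (fun p : A * A => q t p.1 p.2).
    exact: mq_comp.
  have mqt' : measurable_fun setT (fun p : A * A => q t p.2 p.1).
    exact: mq_comp.
  have I_swap : \int[mu]_(a in D) \int[mu]_(b in D) q t a b =
      \int[mu]_(a in D) \int[mu]_(b in D) q t b a.
    exact: (@Rintegral_fubini _ _ _ _ _ mu mu D D
      (fun p => q t p.1 p.2) (M * W)).
  have half (u v : R) : u + u = - v -> u = - 2^-1 * v by lra.
  apply: half; rewrite {2}I_swap.
  have q_le' u a b : `|q u b a| <= M * W by exact: q_le.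
  have mq_swap : measurable_fun setT
      (fun p : measurableTypeR R * A * A => q p.1.1 p.2 p.1.2).
    exact: (mq_comp _ _ _ _ _ m1 (@measurable_snd _ _ _ A) m2).
  have iG a : mu.-integrable D (EFin \o (fun b => G t a b)).
    by apply: flow_bounded_integrable (G_le t a); exact: mG_comp.
  have iq a : mu.-integrable D (EFin \o (fun b => q t a b)).
    by apply: flow_bounded_integrable (q_le t a); exact: mq_comp.
  have iq' a : mu.-integrable D (EFin \o (fun b => q t b a)).
    by apply: flow_bounded_integrable (q_le t ^~ a); exact: mq_comp.
  have iG1 : mu.-integrable D
      (EFin \o (fun a => \int[mu]_(b in D) G t a b)).
    apply: flow_bounded_integrable (integral1_le mG G_le t).
    exact: (measurable_fun_pair2 t (measurable_integral1 mG G_le)).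
  have iq1 : mu.-integrable D
      (EFin \o (fun a => \int[mu]_(b in D) q t a b)).
    apply: flow_bounded_integrable (integral1_le mq q_le t).
    exact: (measurable_fun_pair2 t (measurable_integral1 mq q_le)).
  have iq1' : mu.-integrable D
      (EFin \o (fun a => \int[mu]_(b in D) q t b a)).
    pose q' (u : measurableTypeR R) a b := q u b a.
    apply: flow_bounded_integrable (integral1_le (h := q') mq_swap q_le' t).
    exact: (measurable_fun_pair2 t
      (measurable_integral1 (h := q') mq_swap q_le')).
  rewrite -(RintegralD mD iq1 iq1') -mulN1r -(RintegralZl (-1) mD iG1).
  apply: eq_Rintegral => a _.
  rewrite -(RintegralD mD (iq a) (iq' a)) -(RintegralZl (-1) mD (iG a)).
  by apply: eq_Rintegral => b _; rewrite /q /G (Ksym t b a); ring.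
- apply: measurable_funM; last exact: mdrift_comp.
  by apply: measurableT_comp => //; exact: flow_measurable_comp.
- by move=> p; rewrite normrM ler_pM// ?f'_le// drift_le.
Qed.

End observable.
End averaging_flow.

(** * Convex observables and the energy *)

Lemma is_derive_half_sqr (R : realType) (y : R) :
  is_derive y 1 (fun u : R => 2^-1 * u ^+ 2) y.
Proof.
have -> : (fun u : R => 2^-1 * u ^+ 2) = 2^-1 *: (id : R -> R) ^+ 2.
  by apply/funext => u; rewrite fctE.
apply: is_derive_eq.
by rewrite /GRing.scale/= expr1 mulr1 mulrA mulVf ?mul1r.
Qed.

Section averaging_flow_limit.
Context d (A : measurableType d) (R : realType)
  (mu : {sigma_finite_measure set A -> \bar R}) (D : set A)
  (K : R -> A -> A -> R) (X : R -> A -> R) (W : R).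
Hypothesis flow : averaging_flow mu D K X W.

Let mD : measurable D := flow_measurable_domain flow.
Let muD : mu D = 1%E := flow_domain_mass flow.
Let X01 := flow_itv flow.
Let K0 := flow_rate_ge0 flow.

Let mXt t : measurable_fun setT (X t).
Proof. exact: (flow_measurable_comp flow). Qed.

Local Notation Phi f t := (\int[mu]_(a in D) f (X t a)).

Let two_point t a b (h : R -> R) :
  (forall u v, 0 <= u -> u <= v -> v <= 1 -> h u <= h v) ->
  0 <= K t a b * (h (X t a) - h (X t b)) * (X t a - X t b).
Proof.
move=> hh; rewrite -mulrA mulr_ge0//.
have /andP[? ?] := X01 t a; have /andP[? ?] := X01 t b.
have [ab|/ltW ba] := leP (X t a) (X t b).
  by rewrite mulr_le0// subr_le0// hh.
by rewrite mulr_ge0// subr_ge0// hh.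
Qed.

(** For nondecreasing [f'] the differences f' (X t a) - f' (X t b) and X t a - X t b have the same
    sign, so the integrand in [observable_variation] is nonnegative. *)
Lemma convex_observable_nonincreasing (f f' : R -> R) L S T :
  (forall y : R, is_derive y 1 f (f' y)) -> measurable_fun setT f' ->
  (forall u v, 0 <= u <= 1 -> 0 <= v <= 1 -> `|f' u - f' v| <= L * `|u - v|) ->
  (forall u v, 0 <= u -> u <= v -> v <= 1 -> f' u <= f' v) ->
  0 <= S -> S <= T -> Phi f T <= Phi f S.
Proof.
move=> df mf' Lf' ndf' S0 ST.
rewrite -subr_le0 (observable_variation flow df mf' Lf' S0 ST).
rewrite mulNr oppr_le0 mulr_ge0//; apply: Rintegral_ge0 => t _.
apply: Rintegral_ge0 => a _; apply: Rintegral_ge0 => b _.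
exact: two_point.
Qed.

Let E t := Phi (fun y => 2^-1 * y ^+ 2) t.

Lemma integrable_observable (f : R -> R) t : continuous f ->
  mu.-integrable D (EFin \o (fun a => f (X t a))).
Proof.
move=> cf.
have [M [_ fM]] : bounded_set (f @` `[0, 1]).
  apply: compact_bounded; apply: continuous_compact.
    exact: continuous_subspaceT.
  exact: segment_compact.
apply: (flow_bounded_integrable flow (M := M + 1)).
  by apply: measurableT_comp => //; exact: continuous_measurable_fun.
move=> a; apply: (fM (M + 1)); first by rewrite ltrDl.
by exists (X t a) => //=; rewrite in_itv/= X01.
Qed.

Lemma derive_continuous (f f' : R -> R) :
  (forall y : R, is_derive y 1 f (f' y)) -> continuous f.
Proof.
by move=> df y; apply/differentiable_continuous/derivable1_diffP; case: (df y).
Qed.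

(* Both [L * y ^+ 2 / 2 - f] and [L * y ^+ 2 / 2 + f] are convex. *)
Lemma observable_variation_le (f f' : R -> R) L S T :
  (forall y : R, is_derive y 1 f (f' y)) -> measurable_fun setT f' ->
  (forall u v, 0 <= u <= 1 -> 0 <= v <= 1 -> `|f' u - f' v| <= L * `|u - v|) ->
  0 <= S -> S <= T -> `|Phi f T - Phi f S| <= L * (E S - E T).
Proof.
move=> df mf' Lf' S0 ST.
have iE t : mu.-integrable D (EFin \o (fun a => 2^-1 * X t a ^+ 2)).
  exact: (integrable_observable _ (derive_continuous (@is_derive_half_sqr R))).
have iLE t : mu.-integrable D (EFin \o (fun a => L * (2^-1 * X t a ^+ 2))).
  apply: (integrable_observable (f := fun y => L * (2^-1 * y ^+ 2))).
  apply: (derive_continuous (f' := fun y => L * y)) => y.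
  exact: (is_deriveZ L (is_derive_half_sqr y)).
have iF t := integrable_observable t (derive_continuous df).
have L0 : 0 <= L.
  have := Lf' 0 1.
  rewrite !lexx !ler01 sub0r normrN normr1 mulr1 => /(_ isT isT).
  exact: le_trans.
have Lmono u v : 0 <= u -> u <= v -> v <= 1 ->
    `|f' u - f' v| <= L * v - L * u.
  move=> u0 uv v1; rewrite -mulrBr -(ger0_norm (_ : 0 <= v - u)) ?subr_ge0//.
  by rewrite (distrC v u); apply: Lf'; apply/andP; split; lra.
have Llip u v : 0 <= u <= 1 -> 0 <= v <= 1 ->
    `|L * u - L * v| + `|f' u - f' v| <= (L + L) * `|u - v|.
  by move=> u01 v01; rewrite -mulrBr normrM (ger0_norm L0) mulrDl lerD2l Lf'.
rewrite ler_norml; apply/andP; split.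
  have := @convex_observable_nonincreasing
    (fun y => L * (2^-1 * y ^+ 2) - f y) (fun y => L * y - f' y) (L + L) S T.
  rewrite !RintegralB// !(RintegralZl L mD (iE _)) => h.
  suff : L * E T - Phi f T <= L * E S - Phi f S by lra.
  apply: h => //.
  - move=> y.
    exact: (is_deriveB (is_deriveZ L (is_derive_half_sqr y)) (df y)).
  - by apply: measurable_funB => //; exact: measurable_funM.
  - move=> u v u01 v01; apply: le_trans (Llip u v u01 v01).
    rewrite (_ : _ - _ = (L * u - L * v) - (f' u - f' v)); last by ring.
    exact: ler_normB.
  - move=> u v u0 uv v1; have := Lmono u v u0 uv v1.
    by rewrite ler_norml => /andP[? ?]; lra.
have := @convex_observable_nonincreasing
  (fun y => L * (2^-1 * y ^+ 2) + f y) (fun y => L * y + f' y) (L + L) S T.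
rewrite !RintegralD// !(RintegralZl L mD (iE _)) => h.
suff : L * E T + Phi f T <= L * E S + Phi f S by lra.
apply: h => //.
- move=> y.
  exact: (is_deriveD (is_deriveZ L (is_derive_half_sqr y)) (df y)).
- by apply: measurable_funD => //; exact: measurable_funM.
- move=> u v u01 v01; apply: le_trans (Llip u v u01 v01).
  rewrite (_ : _ - _ = (L * u - L * v) + (f' u - f' v)); last by ring.
  exact: ler_normD.
- move=> u v u0 uv v1; have := Lmono u v u0 uv v1.
  by rewrite ler_norml => /andP[? ?]; lra.
Qed.

Let E_ge0 t : 0 <= E t.
Proof. by apply: Rintegral_ge0 => a _; rewrite mulr_ge0// sqr_ge0. Qed.

Let E_le1 t : E t <= 2^-1.
Proof.
apply: le_trans (ler_norm _) _; apply: (norm_integral_le flow).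
  by apply: measurable_funM => //; exact: measurable_funX.
move=> a; have /andP[? ?] := X01 t a.
by rewrite ger0_norm ?mulr_ge0 ?sqr_ge0// ler_piMr// expr_le1.
Qed.

Lemma energy_nonincreasing S T : 0 <= S -> S <= T -> E T <= E S.
Proof.
move=> S0 ST; apply: (convex_observable_nonincreasing
  (f' := id) (L := 1) (@is_derive_half_sqr R)) => //.
by move=> u v _ _; rewrite mul1r.
Qed.

(** The energy is nonincreasing and bounded below. Combined with [observable_variation_le], its
    small late losses control the late variation of every observable with Lipschitz derivative. *)
Lemma energy_cauchy e : 0 < e ->
  exists2 N, 0 <= N & forall S T, N <= S -> S <= T -> E S - E T <= e.
Proof.
move=> e0; pose I := E @` [set t | 0 <= t].
have hI : has_inf I.
  split; first by exists (E 0), 0 => /=.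
  by exists 0 => _ [t _ <-].
have [_ [N /= N0 <-] EN] := inf_adherent e0 hI.
exists N => // S T NS ST.
have : inf I <= E T.
  apply: ge_inf; first by case: hI.
  by exists T => //=; lra.
have := energy_nonincreasing N0 NS; lra.
Qed.

Definition dissipation (t : R) := \int[mu]_(a in D) \int[mu]_(b in D)
  (K t a b * (X t a - X t b) * (X t a - X t b)).

(** The energy lies in [0, 1/2] and decreases at half the rate of [dissipation], whence the constant
    1 for every interval. *)
Lemma dissipation_integral S T : 0 <= S -> S <= T ->
  \int[lebesgue_measure]_(t in `[S, T]) dissipation t <= 1.
Proof.
move=> S0 ST.
have := @observable_variation _ _ _ _ _ _ _ _ flow _ id 1
  (@is_derive_half_sqr R) _ _ S T S0 ST.
have := E_ge0 T; have := E_le1 S; rewrite -/(E S) -/(E T) => ? ? h.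
have : E T - E S = - 2^-1 * \int[lebesgue_measure]_(t in `[S, T]) dissipation t.
  by apply: h => // u v _ _; rewrite mul1r.
lra.
Qed.

End averaging_flow_limit.

(** * Bump functions with Lipschitz derivative *)

Lemma linear_approx_is_derive (R : realType) (F : R -> R) (c q : R) :
  (forall e, 0 < e -> exists2 d, 0 < d &
    forall y, `|y - c| < d -> `|F y - F c - q * (y - c)| <= e * `|y - c|) ->
  is_derive c 1 F q.
Proof.
move=> approx.
have : h^-1 *: (F (h *: 1 + c) - F c) @[h --> 0^'] --> q.
  apply/cvgrPdist_le => e e0; have [d d0 Hd] := approx e e0.
  rewrite /dnbhs/within/=; exists d => //= h; rewrite /ball/= sub0r normrN.
  move=> hd hne; have := Hd (h + c); rewrite addrK => /(_ hd).
  rewrite /GRing.scale/= mulr1 => H.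
  have -> : q - h^-1 * (F (h + c) - F c) =
    - (h^-1 * (F (h + c) - F c - q * h)) by field.
  by rewrite normrN normrM normfV mulrC ler_pdivrMr ?normr_gt0.
move=> Fq; apply: DeriveDef; first by apply/cvg_ex; exists q; exact: Fq.
exact: cvg_lim Fq.
Qed.

Section bump.
Context (R : realType).
Implicit Types u v y z e : R.

Definition sqr_pos_part u : R := Num.max 0 u ^+ 2.

Lemma is_derive_sqr_pos_part u :
  is_derive u 1 sqr_pos_part (2 * Num.max 0 u).
Proof.
(* The error of the linear approximation is at most (v - u)^2, so the radius [e] itself will do. *)
apply: linear_approx_is_derive => e e0; exists e => // v vu.
apply: le_trans (_ : `|v - u| ^+ 2 <= _); last first.
  by rewrite expr2 ler_wpM2r// ltW.
rewrite real_normK ?num_real// /sqr_pos_part.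
have ? := sqr_ge0 (v - u).
by rewrite ler_norml; apply/andP; split; case: (leP 0 u) => ?;
  case: (leP 0 v) => ?; nra.
Qed.

(** Squaring the positive part makes the derivative vanish continuously at the edge of the support,
    and Lipschitz on [0, 1] as [observable_variation_le] requires. *)
Definition bump z e y : R := sqr_pos_part (e ^+ 2 - (y - z) ^+ 2).

Definition bump' z e y : R :=
  2 * Num.max 0 (e ^+ 2 - (y - z) ^+ 2) * - (2 * (y - z)).

Lemma is_derive_bump z e y : is_derive y 1 (bump z e) (bump' z e y).
Proof.
have dg : is_derive y 1 (fun u : R => e ^+ 2 - (u - z) ^+ 2) (- (2 * (y - z))).
  apply: linear_approx_is_derive => d d0; exists d => // v vy.
  rewrite (_ : _ - _ = - (v - y) ^+ 2); last by ring.
  by rewrite normrN normrX expr2 ler_wpM2r// ltW.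
exact: (is_derive1_comp (f := sqr_pos_part)
  (g := fun u : R => e ^+ 2 - (u - z) ^+ 2) (is_derive_sqr_pos_part _)).
Qed.

Lemma measurable_bump' z e : measurable_fun setT (bump' z e).
Proof.
apply: measurable_funM.
  apply: measurable_funM => //; apply: measurable_maxr => //.
  apply: measurable_funB => //; apply: measurable_funX.
  exact: measurable_funB.
apply: measurableT_comp => //; apply: measurable_funM => //.
exact: measurable_funB.
Qed.

(** The positive parts are at most e^2, they differ by at most |u - v| |(u - z) + (v - z)| <= 2 |u -
    v|, and |v - z| <= 1. The factor 4 collects the two factors 2 of [bump']. *)
Lemma bump'_lipschitz z e u v : 0 <= z <= 1 -> 0 <= u <= 1 -> 0 <= v <= 1 ->
  `|bump' z e u - bump' z e v| <= 4 * (e ^+ 2 + 2) * `|u - v|.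
Proof.
move=> /andP[z0 z1] /andP[u0 u1] /andP[v0 v1]; rewrite /bump'.
set P := Num.max 0 _; set Q := Num.max 0 (_ - (v - z) ^+ 2).
have -> : 2 * P * - (2 * (u - z)) - 2 * Q * - (2 * (v - z)) =
  - (4 * (P * (u - v) + (P - Q) * (v - z))) by ring.
rewrite normrN normrM ger0_norm// -mulrA ler_wpM2l//.
apply: le_trans (ler_normD _ _) _; rewrite [leRHS]mulrDl lerD//.
  rewrite normrM ler_wpM2r// ger0_norm /P ?le_max ?lexx//.
  by rewrite ge_max sqr_ge0 gerBl sqr_ge0.
have PQ : `|P - Q| <= `|(u - z) ^+ 2 - (v - z) ^+ 2|.
  rewrite /P /Q; have := ler_norm ((u - z) ^+ 2 - (v - z) ^+ 2).
  have := ler_norm (- ((u - z) ^+ 2 - (v - z) ^+ 2)); rewrite normrN.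
  have := normr_ge0 ((u - z) ^+ 2 - (v - z) ^+ 2).
  move=> h0 h1 h2.
  rewrite ler_norml; apply/andP.
  by case: (leP 0 (e ^+ 2 - (u - z) ^+ 2)) => ?;
    case: (leP 0 (e ^+ 2 - (v - z) ^+ 2)) => ?; split; lra.
rewrite normrM -[leRHS]mulr1; apply: ler_pM => //; last first.
  by rewrite ler_norml; apply/andP; split; lra.
apply: le_trans PQ _.
rewrite (_ : _ - _ = (u - v) * (u - z + (v - z))); last by ring.
rewrite normrM mulrC ler_wpM2r// ler_norml; apply/andP; split; lra.
Qed.

Lemma bump_le z e y : 0 < e ->
  bump z e y <= e ^+ 4 * \1_(`]z - e, z + e[) y.
Proof.
move=> e0; rewrite indicE; have [|] := boolP (y \in _).
  move=> _; rewrite mulr1 /bump /sqr_pos_part.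
  rewrite (_ : e ^+ 4 = (e ^+ 2) ^+ 2); last by rewrite -exprM.
  rewrite ler_pXn2r ?nnegrE ?sqr_ge0 ?le_max ?lexx//.
  by rewrite ge_max sqr_ge0 gerBl sqr_ge0.
rewrite notin_setE/= in_itv/= => /negP yz; rewrite mulr0 /bump /sqr_pos_part.
rewrite (max_idPl _) ?expr0n//= subr_le0.
move: yz; rewrite negb_and -!leNgt => /orP[|] ?; nra.
Qed.

(** Within e / 2 of [z] the difference e^2 - (y - z)^2 is at least 3/4 e^2, and 9/16 is the square
    of 3/4. *)
Lemma bump_ge z e y : 0 < e ->
  (9 / 16) * e ^+ 4 * \1_(`]z - e / 2, z + e / 2[) y <= bump z e y.
Proof.
move=> e0; rewrite indicE; have [|] := boolP (y \in _); last first.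
  by move=> _; rewrite mulr0 sqr_ge0.
rewrite inE/= in_itv/= => /andP[zy yz]; rewrite mulr1 /bump /sqr_pos_part.
rewrite (_ : 9 / 16 * e ^+ 4 = (3 / 4 * e ^+ 2) ^+ 2); last by lra.
have e2 : 0 <= 3 / 4 * e ^+ 2 by rewrite mulr_ge0 ?sqr_ge0.
have le : 3 / 4 * e ^+ 2 <= Num.max 0 (e ^+ 2 - (y - z) ^+ 2).
  by rewrite le_max; apply/orP; right; nra.
by rewrite ler_pXn2r// nnegrE (le_trans e2).
Qed.

End bump.

(** * Clusters and their separation *)

Lemma lebesgue_measure_itvcc (R : realType) (s t : R) :
  s <= t -> @lebesgue_measure R `[s, t] = (t - s)%:E.
Proof.
move=> st; rewrite lebesgue_measure_itv/= lte_fin; case: ltP => // ts.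
by rewrite (le_anti (_ : s <= t <= s)) ?st ?ts// subrr.
Qed.

Lemma Rintegral_segment_ge (R : realType) (f : R -> R) (S T k : R) :
  S <= T -> (@lebesgue_measure R).-integrable `[S, T] (EFin \o f) ->
  (forall t, S <= t <= T -> k <= f t) ->
  k * (T - S) <= \int[lebesgue_measure]_(t in `[S, T]) f t.
Proof.
move=> ST intf kf.
have -> : k * (T - S) = \int[lebesgue_measure]_(t in `[S, T]) k.
  rewrite Rintegral_cst//; congr (_ * _).
  by rewrite [X in fine X](lebesgue_measure_itvcc ST).
apply: le_Rintegral => //.
apply: (@bounded_integrable _ _ _ _ _ _ `|k|) => //.
exact: lebesgue_segment_lty.
Qed.

Section clusters.
Context d (A : measurableType d) (R : realType)
  (mu : {sigma_finite_measure set A -> \bar R}) (D : set A)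
  (K : R -> A -> A -> R) (X : R -> A -> R) (W : R).
Hypothesis flow : averaging_flow mu D K X W.

Let mD : measurable D := flow_measurable_domain flow.
Let muD : mu D = 1%E := flow_domain_mass flow.
Let X01 := flow_itv flow.

Let mXt t : measurable_fun setT (X t).
Proof. exact: (flow_measurable_comp flow). Qed.

Definition mass (B : set R) t := \int[mu]_(a in D) \1_B (X t a).

Definition nearby (z e : R) : set R := `]z - e, z + e[%classic.

Lemma measurable_nearby z e : measurable (nearby z e).
Proof. exact: measurable_itv. Qed.
#[local] Hint Resolve measurable_nearby : core.

(** The lower bound holds at all late times, not just at arbitrarily late ones, so that two clusters
    interact without interruption. *)
Definition cluster z := forall e, 0 < e -> exists2 c, 0 < c &
  exists N : R, forall t, N <= t -> c <= mass (nearby z e) t.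

Definition vanishing B := forall c, 0 < c ->
  exists N : R, forall t, N <= t -> mass B t <= c.

Lemma mass_integrable B t : measurable B ->
  mu.-integrable D (EFin \o (fun a => \1_B (X t a) : R)).
Proof.
move=> mB; apply: (flow_bounded_integrable flow (M := 1)).
  by apply: measurableT_comp => //; exact: measurable_indic.
by move=> a; rewrite indicE; case: (_ \in _); rewrite /= ?normr1 ?normr0.
Qed.

Lemma mass_ge0 B t : 0 <= mass B t.
Proof. by apply: Rintegral_ge0. Qed.

Lemma mass_le B C t : measurable B -> measurable C -> B `<=` C ->
  mass B t <= mass C t.
Proof.
move=> mB mC BC; apply: le_Rintegral => //; try exact: mass_integrable.
move=> a _; rewrite !indicE.
have [XB|] := boolP (X t a \in B); last by rewrite ler0n.
by rewrite (mem_set (BC _ (set_mem XB))).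
Qed.

Lemma mass_setU B C t : measurable B -> measurable C ->
  mass (B `|` C) t <= mass B t + mass C t.
Proof.
move=> mB mC; rewrite /mass -RintegralD//; try exact: mass_integrable.
apply: le_Rintegral => //.
- by apply: mass_integrable; exact: measurableU.
- apply: (flow_bounded_integrable flow (M := 2)).
    by apply: measurable_funD; apply: measurableT_comp => //;
      exact: measurable_indic.
  move=> a; rewrite !indicE.
  by case: (_ \in B); case: (_ \in C);
    rewrite /= ?addr0 ?add0r ?normr0 ?normr1 ?ger0_norm// ler1n.
- move=> a _; rewrite !indicE in_setU.
  by case: (_ \in B); case: (_ \in C); rewrite /= ?addr0 ?add0r// lerDl.
Qed.

(* The mass weighted by a bump around z converges; it is squeezed between the
   masses of two neighbourhoods of z. *)
Lemma mass_dichotomy z : 0 <= z <= 1 ->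
  cluster z \/ exists2 e, 0 < e & vanishing (nearby z e).
Proof.
move=> z01; have [|nz] := pselect (cluster z); [by left|right].
have [e [e0 He]] : exists e, 0 < e /\ forall c N, 0 < c ->
    exists2 t, N <= t & mass (nearby z e) t < c.
  apply: contrapT => h; apply: nz => e e0; apply: contrapT => h2; apply: h.
  exists e; split => // c N c0; apply: contrapT => h3; apply: h2.
  exists c => //; exists N => t Nt; rewrite leNgt; apply/negP => tc.
  by apply: h3; exists t.
exists (e / 2); first by rewrite divr_gt0.
move=> c c0; pose L := 4 * (e ^+ 2 + 2).
have L0 : 0 < L by rewrite mulr_gt0// ltr_wpDl// sqr_ge0.
have e40 : 0 < e ^+ 4 by rewrite exprn_gt0.
(* At some late [t0] the integral of the bump is below [h], and from then on the remaining energy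
   loss lets it change by at most [h]. The sum 2 h is [c] times the lower bound of the bump on the
   half neighbourhood. *)
pose h := c * (9 / 16 * e ^+ 4) / 2.
have h0 : 0 < h by rewrite !mulr_gt0.
have [N N0 HN] := energy_cauchy flow (divr_gt0 h0 L0).
have [t0 Nt0 ct0] := He (h / e ^+ 4) N (divr_gt0 h0 e40).
have iB t : mu.-integrable D (EFin \o (fun a => bump z e (X t a))).
  apply: (integrable_observable flow).
  exact: (derive_continuous (is_derive_bump z e)).
have up t : \int[mu]_(a in D) bump z e (X t a) <= e ^+ 4 * mass (nearby z e) t.
  rewrite /mass -RintegralZl//; last first.
    exact: (mass_integrable _ (measurable_nearby _ _)).
  apply: le_Rintegral => //; last by move=> a _; exact: bump_le.
  apply: (flow_bounded_integrable flow (M := e ^+ 4)).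
    apply: measurable_funM => //.
    by apply: measurableT_comp => //; exact: measurable_indic.
  move=> a; rewrite indicE normrM (ger0_norm (ltW e40)) ler_piMr ?(ltW e40)//.
  by case: (_ \in _); rewrite ?normr1 ?normr0.
have down t : 9 / 16 * e ^+ 4 * mass (nearby z (e / 2)) t <=
    \int[mu]_(a in D) bump z e (X t a).
  rewrite /mass -RintegralZl//; last first.
    exact: (mass_integrable _ (measurable_nearby _ _)).
  apply: le_Rintegral => //; last by move=> a _; exact: bump_ge.
  have g0 : 0 <= 9 / 16 * e ^+ 4 by rewrite mulr_ge0// ltW.
  apply: (flow_bounded_integrable flow (M := 9 / 16 * e ^+ 4)).
    apply: measurable_funM => //.
    by apply: measurableT_comp => //; exact: measurable_indic.
  move=> a; rewrite indicE normrM (ger0_norm g0) ler_piMr//.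
  by case: (_ \in _); rewrite ?normr1 ?normr0.
exists t0 => t t0t.
have := observable_variation_le flow (is_derive_bump z e) (measurable_bump' z e)
  (fun u v u01 v01 => bump'_lipschitz e z01 u01 v01) (le_trans N0 Nt0) t0t.
have := HN _ _ Nt0 t0t; rewrite ler_pdivlMr// mulrC -/L => HE.
move=> /ler_normlP[_ Hvar].
have := up t0; have := down t => dn1 up1.
have up2 : e ^+ 4 * mass (nearby z e) t0 < h.
  by rewrite mulrC -ltr_pdivlMr.
have : 9 / 16 * e ^+ 4 * mass (nearby z (e / 2)) t <= h + h by lra.
rewrite -[h + h](_ : c * (9 / 16 * e ^+ 4) = _); last by rewrite /h; lra.
by rewrite mulrC ler_pM2r// mulr_gt0.
Qed.

(** The dissipation of one pair, [K] times the squared distance, in the shape that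
    [observable_variation] gives it for the derivative [id]. *)
Definition pull (t : R) (a b : A) : R :=
  K t a b * (X t a - X t b) * (X t a - X t b).

Lemma measurable_pull : measurable_fun setT
  (fun p : measurableTypeR R * A * A => pull p.1.1 p.1.2 p.2).
Proof.
have m1 : measurable_fun setT (fun p : measurableTypeR R * A * A => p.1.1).
  exact: measurableT_comp.
have m2 : measurable_fun setT (fun p : measurableTypeR R * A * A => p.1.2).
  exact: measurableT_comp.
apply: measurable_funM; last first.
  by apply: measurable_funB; exact: (flow_measurable_comp flow).
apply: measurable_funM; first exact: (flow_measurable_rate_comp flow).
by apply: measurable_funB; exact: (flow_measurable_comp flow).
Qed.

Lemma pull_ge0 t a b : 0 <= pull t a b.
Proof.
by rewrite /pull -mulrA mulr_ge0 ?(flow_rate_ge0 flow)// -expr2 sqr_ge0.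
Qed.

Lemma pull_le t a b : `|pull t a b| <= W.
Proof.
rewrite ger0_norm ?pull_ge0// /pull -mulrA -[leRHS]mulr1 ler_pM//.
- exact: (flow_rate_ge0 flow).
- by rewrite -expr2 sqr_ge0.
- exact: (flow_rate_le flow).
- have /andP[? ?] := X01 t a; have /andP[? ?] := X01 t b; nra.
Qed.

Lemma pull_integrable t a : mu.-integrable D (EFin \o pull t a).
Proof.
apply: (flow_bounded_integrable flow (M := W)); last exact: pull_le.
exact: (measurable_fun_pair2 ((t : measurableTypeR R), a) measurable_pull).
Qed.

Variables r Delta : R.
Hypothesis r0 : 0 < r.
Hypothesis Delta0 : 0 < Delta.
Hypothesis Gamma : forall t a b, `|X t a - X t b| <= r -> Delta <= K t a b.

(* Two clusters at distance less than r attract each other at a positive rate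
   forever, against the finite total dissipation. *)
Lemma cluster_separated z z' : cluster z -> cluster z' -> z < z' ->
  r <= z' - z.
Proof.
move=> cz cz' zz'; rewrite leNgt; apply/negP => zr.
pose dl := z' - z; have dlE : dl = z' - z by [].
have dl0 : 0 < dl by rewrite subr_gt0.
(* With e <= dl / 4, agents near [z] and [z'] stay at least dl / 2 apart; with e <= (r - dl) / 2,
   they stay within [r]. Each such pair then dissipates at least [k]. *)
pose e := Num.min (dl / 4) ((r - dl) / 2).
have e0 : 0 < e by rewrite lt_min !divr_gt0// subr_gt0.
have edl : e <= dl / 4 by rewrite ge_min lexx.
have er : e <= (r - dl) / 2 by rewrite ge_min lexx orbT.
have [c c0 [N HN]] := cz e e0; have [c' c'0 [N' HN']] := cz' e e0.
pose k := Delta * (dl / 2) ^+ 2.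
have k0 : 0 < k by rewrite mulr_gt0// exprn_gt0// divr_gt0.
pose H := dissipation mu D K X.
have Hge t : N <= t -> N' <= t -> k * (c * c') <= H t.
  move=> Nt N't.
  apply: le_trans (_ : k * (mass (nearby z e) t * mass (nearby z' e) t) <= _).
    rewrite ler_pM2l//; apply: ler_pM.
    - exact: ltW.
    - exact: ltW.
    - exact: HN.
    - exact: HN'.
  rewrite mulrCA mulrC [mass (nearby z e) t]/mass -RintegralZl//; last first.
    exact: (mass_integrable _ (measurable_nearby _ _)).
  apply: le_Rintegral => //.
  - apply: (flow_bounded_integrable flow (M := k * mass (nearby z' e) t)).
      apply: measurable_funM => //.
      by apply: measurableT_comp => //; exact: measurable_indic.
    move=> a; have km : 0 <= k * mass (nearby z' e) t.
      by rewrite mulr_ge0 ?mass_ge0// ltW.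
    rewrite indicE normrM (ger0_norm km) ler_piMr//.
    by case: (_ \in _); rewrite ?normr1 ?normr0.
  - apply: (flow_bounded_integrable flow (M := W)); last first.
      exact: (integral1_le flow measurable_pull pull_le t).
    exact: (measurable_fun_pair2 t
      (measurable_integral1 flow measurable_pull pull_le)).
  move=> a _; rewrite indicE.
  have [Xa|_] := boolP (X t a \in _); last first.
    by rewrite mulr0; apply: Rintegral_ge0 => b _; exact: pull_ge0.
  rewrite mulr1 /mass -RintegralZl//; last first.
    exact: (mass_integrable _ (measurable_nearby _ _)).
  apply: le_Rintegral => //.
  - apply: (flow_bounded_integrable flow (M := k)).
      apply: measurable_funM => //.
      by apply: measurableT_comp => //; exact: measurable_indic.
    move=> b; rewrite indicE normrM (ger0_norm (ltW k0)) ler_piMr ?(ltW k0)//.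
    by case: (_ \in _); rewrite ?normr1 ?normr0.
  - exact: pull_integrable.
  move=> b _; rewrite indicE.
  have [Xb|_] := boolP (X t b \in _); last by rewrite mulr0 pull_ge0.
  move: Xa Xb; rewrite !inE /nearby/= !in_itv/= => /andP[? ?] /andP[? ?].
  rewrite mulr1 -mulrA; apply: ler_pM; [exact: ltW|exact: sqr_ge0| |].
    by apply: Gamma; rewrite ler_norml; apply/andP; split; lra.
  rewrite -expr2 -[leRHS]sqrrN ler_pXn2r ?nnegrE//; lra.
pose S := Num.max 0 (Num.max N N').
have S0 : 0 <= S by rewrite le_max lexx.
(* Over this duration the lower bound on the dissipation integrates to 2, while the total is at most
   1. *)
pose T := S + (k * (c * c'))^-1 * 2.
have kc0 : 0 < k * (c * c') by rewrite !mulr_gt0.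
have ST : S <= T by rewrite lerDl mulr_ge0// invr_ge0 ltW.
have := dissipation_integral flow S0 ST.
apply/negP; rewrite -ltNge.
apply: lt_le_trans (_ : k * (c * c') * (T - S) <= _).
  rewrite /T [S + _]addrC addrK mulrA divff ?gt_eqF// mul1r.
  by rewrite ltr1n.
apply: Rintegral_segment_ge => //.
  exact: (integrable_integral2 flow S T measurable_pull pull_le).
move=> t /andP[St tT]; apply: Hge; apply: le_trans St.
  by rewrite !le_max lexx orbT.
by rewrite !le_max lexx !orbT.
Qed.

End clusters.

(** * Recurrence near the clusters *)

Section visits.
Context d (A : measurableType d) (R : realType)
  (mu : {sigma_finite_measure set A -> \bar R}) (D : set A)
  (K : R -> A -> A -> R) (X : R -> A -> R) (W : R).
Hypothesis flow : averaging_flow mu D K X W.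

Let mD : measurable D := flow_measurable_domain flow.
Let X01 := flow_itv flow.

Let mXt t : measurable_fun setT (X t).
Proof. exact: (flow_measurable_comp flow). Qed.

Local Notation mass := (mass mu D X).
Local Notation vanishing := (vanishing mu D X).

Definition limit_points : set R :=
  [set z | 0 <= z <= 1 /\ cluster mu D X z].

Definition away (rho : R) : set R :=
  `[0, 1]%classic `\` \bigcup_(z in limit_points) nearby z rho.

Lemma measurable_away rho : measurable (away rho).
Proof.
apply: measurableD => //; apply: open_measurable.
by apply: bigcup_open => z _; exact: interval_open.
Qed.

Lemma vanishingS B C : measurable B -> measurable C -> B `<=` C ->
  vanishing C -> vanishing B.
Proof.
move=> mB mC BC vC c c0; have [N HN] := vC c c0; exists N => t Nt.
apply: le_trans (HN t Nt); exact: (mass_le flow).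
Qed.

Lemma vanishingU B C : measurable B -> measurable C ->
  vanishing B -> vanishing C -> vanishing (B `|` C).
Proof.
move=> mB mC vB vC c c0; have c20 : 0 < c / 2 by rewrite divr_gt0.
have [N HN] := vB _ c20; have [N' HN'] := vC _ c20.
exists (Num.max N N') => t; rewrite ge_max => /andP[Nt N't].
apply: le_trans (mass_setU flow _ mB mC) _.
have := HN _ Nt; have := HN' _ N't; lra.
Qed.

(** Compactness of [0, 1], through [interval_induction]: a short interval around a limit point
    misses [away rho] altogether, and any other point has, by [mass_dichotomy], a neighbourhood
    whose mass vanishes. *)
Lemma vanishing_away rho : 0 < rho -> vanishing (away rho).
Proof.
move=> rho0; have mB := measurable_away rho.
have mBI s t : measurable (away rho `&` `[s, t]) by exact: measurableI.
suff : vanishing (away rho `&` `[0, 1]).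
  by apply: vanishingS => // y By; split => //; case: By.
apply: (@interval_induction R (fun s t => vanishing (away rho `&` `[s, t]))).
- exact: ler01.
- move=> s m t _ sm mt _ vsm vmt.
  apply: vanishingS (vanishingU _ _ vsm vmt) => //; first exact: measurableU.
  move=> y [By]; rewrite /= in_itv/= => /andP[sy yt].
  by have [ym|/ltW my] := leP y m; [left|right]; split => //;
    rewrite /= in_itv/= ?sy ?ym ?my ?yt.
- move=> c c01; have [cc|[e e0 ve]] := mass_dichotomy flow c01.
    exists rho => // s t _ sc ct _ tsrho.
    apply: (vanishingS (C := set0)) => //.
      move=> y [[_ By]]; rewrite /= in_itv/= => /andP[sy yt]; apply: By.
      by exists c => //; rewrite /nearby /= in_itv/=; apply/andP; split; lra.
    move=> k k0; exists 0 => u _; rewrite /mass/=.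
    under eq_Rintegral do rewrite indic0.
    by rewrite Rintegral_cst// mul0r ltW.
  exists e => // s t _ sc ct _ tse; apply: vanishingS ve => //.
    exact: measurable_nearby.
  move=> y [_]; rewrite /= /nearby/= !in_itv/= => /andP[sy yt].
  by apply/andP; split; lra.
Qed.

Lemma massE B t : measurable B -> (mass B t)%:E = mu (X t @^-1` B `&` D).
Proof.
move=> mB; have mXB : measurable (X t @^-1` B).
  by rewrite -[X in measurable X]setTI; exact: mXt.
rewrite -integral_indic//.
rewrite /mass /Rintegral fineK//.
exact: (integrable_fin_num mD (mass_integrable flow t mB)).
Qed.

(** The agents found in [away rho] at all integer times from N on are, for each k >= N, among those
    found there at time k, and the measure of the latter tends to 0. Integer times keep the
    intersections and unions countable. *)
Lemma negligible_eventually_away rho : 0 < rho -> {ae mu, forall a, D a ->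
  forall N : nat, exists2 k : nat, (N <= k)%N & exists2 z, limit_points z &
    `|X k%:R a - z| < rho}.
Proof.
move=> rho0; have mB := measurable_away rho.
pose F (N : nat) := \bigcap_(k in [set k | (N <= k)%N])
  (X k%:R @^-1` away rho `&` D).
have mF k : measurable (X k%:R @^-1` away rho `&` D).
  by apply: measurableI => //; rewrite -[X in measurable X]setTI; exact: mXt.
have F0 N : mu.-negligible (F N).
  exists (F N); split => //.
    by apply: bigcap_measurable => //; exists N => /=.
  apply/eqP; rewrite eq_le measure_ge0 andbT; apply/lee_addgt0Pr => e e0.
  rewrite add0e; have [M HM] := vanishing_away rho0 e0.
  pose k := maxn N (Num.truncn M).+1.
  apply: le_trans (_ : mu (X k%:R @^-1` away rho `&` D) <= _)%E.
    apply: le_measure; rewrite ?inE//.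
      by apply: bigcap_measurable => //; exists N => /=.
    by apply: bigcap_inf => /=; rewrite leq_maxl.
  rewrite -massE// lee_fin; apply: HM.
  apply: le_trans (ltW (truncnS_gt M)) _; rewrite ler_nat leq_maxr//.
apply: (negligibleS _ (negligible_bigcup F0)) => a /= /not_implyP[Da].
move=> /existsNP[N HN]; exists N => // k /= Nk; split => //=; split.
  by rewrite /= in_itv/= X01.
move=> [z Zz]; rewrite /nearby /= in_itv/= => /andP[h1 h2]; apply: HN.
by exists k => //; exists z => //; rewrite ltr_norml; apply/andP; split; lra.
Qed.

(** The limit point may still change with [n] and [N]; finiteness of [limit_points] will fix it. *)
Lemma ae_recurrent : {ae mu, forall a, D a -> forall n N : nat,
  exists2 k : nat, (N <= k)%N & exists2 z, limit_points z &
    `|X k%:R a - z| < n.+1%:R^-1}.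
Proof.
have h (n : nat) : {ae mu, forall a, D a -> forall N : nat, exists2 k : nat,
    (N <= k)%N & exists2 z, limit_points z & `|X k%:R a - z| < n.+1%:R^-1}.
  by apply: negligible_eventually_away; rewrite invr_gt0.
have := ae_foralln h; move=> /ae_imply; apply => a H Da n N; exact: H.
Qed.

End visits.

(** * Dissipation of a single agent and convergence of its path *)

Lemma ae_bounded_nondecreasing d (A : measurableType d) (R : realType)
    (mu : {measure set A -> \bar R}) (D : set A) (F : nat -> A -> R) (c : R) :
  measurable D -> (forall n, measurable_fun setT (F n)) ->
  (forall n a, 0 <= F n a) ->
  (forall a m n, (m <= n)%N -> F m a <= F n a) ->
  (forall n, (\int[mu]_(a in D) (F n a)%:E <= c%:E)%E) ->
  {ae mu, forall a, D a -> exists C, forall n, F n a <= C}.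
Proof.
move=> mD mF F0 ndF Fc.
pose g n a := (F n a)%:E.
have mg n : measurable_fun D (g n).
  by apply/measurable_EFinP; exact: measurable_funTS.
have g0 n a : D a -> (0 <= g n a)%E by rewrite lee_fin.
have ndg a : D a -> nondecreasing_seq (g ^~ a).
  by move=> _ m n mn; rewrite lee_fin ndF.
(* By monotone convergence the limit has integral at most [c], so it is finite almost everywhere;
   where it is finite, it bounds the sequence. *)
pose G a := limn (g ^~ a).
have G_cvg a : D a -> g ^~ a @ \oo --> ereal_sup (range (g ^~ a)).
  by move=> Da; exact/ereal_nondecreasing_cvgn/ndg.
have GE a : D a -> G a = ereal_sup (range (g ^~ a)).
  by move=> Da; apply/cvg_lim => //; exact: G_cvg.
have intG : (\int[mu]_(a in D) G a <= c%:E)%E.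
  rewrite monotone_convergence//; apply: lime_le.
    by apply: ereal_nondecreasing_is_cvgn => m n mn;
      apply: ge0_le_integral => //;
      move=> a Da; first [exact: g0|exact: ndg].
  by apply: nearW => n; exact: Fc.
have iG : mu.-integrable D G.
  apply/integrableP; split.
    apply: (emeasurable_fun_cvg g) => // a Da.
    by rewrite GE//; exact: G_cvg.
  under eq_integral => a /set_mem Da.
    rewrite gee0_abs; last first.
      rewrite GE//; apply: le_trans (g0 0%N a Da) _.
      by apply: ereal_sup_ubound; exists 0%N.
    over.
  by rewrite (le_lt_trans intG)// ltry.
apply: (ae_imply (integrable_ae mD iG)) => a Gfin Da.
have Ga := Gfin Da; exists (fine (G a)) => n.
rewrite -lee_fin fineK// GE//; apply: ereal_sup_ubound; by exists n.
Qed.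

Section crossing.
Context d (A : measurableType d) (R : realType)
  (mu : {sigma_finite_measure set A -> \bar R}) (D : set A)
  (K : R -> A -> A -> R) (X : R -> A -> R) (W : R).
Hypothesis flow : averaging_flow mu D K X W.
Variables r Delta : R.
Hypothesis r0 : 0 < r.
Hypothesis Delta0 : 0 < Delta.
Hypothesis Gamma : forall t a b, `|X t a - X t b| <= r -> Delta <= K t a b.

Let mD : measurable D := flow_measurable_domain flow.
Let muD : mu D = 1%E := flow_domain_mass flow.
Let X01 := flow_itv flow.

Let muD_lty : (mu D < +oo)%E. Proof. by rewrite muD ltry. Qed.

Local Notation mass := (mass mu D X).

(** The share of agent [a] in [dissipation]; [total] accumulates it from time 0. *)
Let strain t a := \int[mu]_(b in D) pull K X t a b.

Let measurable_strain :
  measurable_fun setT (fun p : measurableTypeR R * A => strain p.1 p.2).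
Proof.
exact: (measurable_integral1 flow (measurable_pull flow) (pull_le flow)).
Qed.

Let strain_le t a : `|strain t a| <= W.
Proof. exact: (integral1_le flow (measurable_pull flow) (pull_le flow)). Qed.

Let strain_ge0 t a : 0 <= strain t a.
Proof. by apply: Rintegral_ge0 => b _; exact: (pull_ge0 flow). Qed.

Let mstrain a : measurable_fun setT (fun t : measurableTypeR R => strain t a).
Proof. exact: (measurable_fun_pair1 a measurable_strain). Qed.

Let strain_integrable S T a :
  (@lebesgue_measure R).-integrable `[S, T] (EFin \o (fun t => strain t a)).
Proof.
apply: (@bounded_integrable _ _ _ _ _ _ W) => //.
- exact: lebesgue_segment_lty.
- by apply: measurable_funTS; exact: mstrain.
Qed.

Let total T a := \int[lebesgue_measure]_(t in `[0, T]) strain t a.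

Let total_add S T a : 0 <= S -> S <= T ->
  total T a = total S a + \int[lebesgue_measure]_(t in `[S, T]) strain t a.
Proof.
move=> S0 ST; apply/eqP; rewrite addrC -subr_eq; apply/eqP.
rewrite /total (Rintegral_itvB (x := S) (strain_integrable 0 T a)) ?bnd_simp//.
apply: Rintegral_itv_obnd_cbnd.
by apply: integrableS (strain_integrable S T a) => //; exact: subset_itv_oc_cc.
Qed.

Let total_nd S T a : 0 <= S -> S <= T -> total S a <= total T a.
Proof.
move=> S0 ST; rewrite (total_add a S0 ST) lerDl.
by apply: Rintegral_ge0 => t _; exact: strain_ge0.
Qed.

(** By Fubini the mean of [total] over the agents is the integral of [dissipation], at most 1 for
    every horizon. As [total] grows with the horizon, it is bounded for almost every agent. *)
Lemma ae_bounded_strain : {ae mu, forall a, D a ->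
  exists C, forall n : nat, total n%:R a <= C}.
Proof.
have mtotal n : measurable_fun setT (total n).
  apply: (measurable_Rintegral (T2 := measurableTypeR R) (M := W)
    (f := fun p : A * measurableTypeR R => strain p.2 p.1)) => //.
    exact: lebesgue_segment_lty.
  have := measurable_fun_pair (@measurable_snd _ _ A (measurableTypeR R))
    (@measurable_fst _ _ A (measurableTypeR R)).
  exact: (@measurableT_comp _ _ _ _ _ _ _ _ (fun p => (p.2, p.1))
    measurable_strain).
apply: (ae_bounded_nondecreasing (c := 1)) => //.
- by move=> n a; apply: Rintegral_ge0 => t _; exact: strain_ge0.
- by move=> a m n mn; apply: total_nd; rewrite ?ler0n ?ler_nat.
- move=> n.
  have itotal : mu.-integrable D (EFin \o total n%:R).
    apply: (flow_bounded_integrable flow (M := W * n%:R)) => // a.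
    apply: le_trans (norm_Rintegral_le (M := W) _ _ _ _) _ => //.
    - exact: lebesgue_segment_lty.
    - by apply: measurable_funTS; exact: mstrain.
    - by rewrite [X in fine X](lebesgue_measure_itvcc (ler0n R n)) subr0.
  rewrite -[leLHS]fineK; last exact: (integrable_fin_num mD itotal).
  rewrite lee_fin -/(Rintegral mu D (total n%:R)).
  apply: le_trans (dissipation_integral flow (lexx 0) (ler0n _ n)).
  rewrite /total.
  have /= <- := @Rintegral_fubini _ _ (measurableTypeR R) A R
    lebesgue_measure mu `[0, n%:R]%classic D (fun p => strain p.1 p.2) W
    (measurable_itv `[0, n%:R]) mD (lebesgue_segment_lty 0 n%:R) muD_lty
    measurable_strain (fun p => strain_le p.1 p.2).
  exact: lexx.
Qed.

(* Each excursion from within q/4 of z to beyond q crosses the ring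
   3q/8 <= |y - z| <= 5q/8, where the strain is bounded below, at bounded
   speed. *)
Lemma recurrent_cluster_cvg a z C :
  (forall n : nat, total n%:R a <= C) -> cluster mu D X z ->
  (forall n N : nat, exists2 k : nat, (N <= k)%N &
    `|X k%:R a - z| < n.+1%:R^-1) ->
  X t a @[t --> +oo] --> z.
Proof.
move=> totC cz rec.
pose W1 := W + 1.
have W10 : 0 < W1.
  rewrite ltr_wpDl//.
  exact: le_trans (flow_rate_ge0 flow 0 a a) (flow_rate_le flow 0 a a).
have lip s t : s <= t -> `|X t a - X s a| <= W1 * (t - s).
  move=> st; apply: le_trans (flow_lipschitz flow a st) _.
  by rewrite ler_wpM2r ?subr_ge0// /W1 lerDl.
pose u t := `|X t a - z|.
have lipu s t : s <= t -> `|u t - u s| <= W1 * (t - s).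
  move=> st; apply: le_trans (lip s t st).
  apply: le_trans (ler_dist_dist _ _) _.
  by rewrite opprB addrA subrK.
have cu : continuous u.
  move=> t; apply/cvgrPdist_lt => e e0; apply/nbhs_ballP.
  exists (e / W1) => /=; first exact: divr_gt0.
  move=> s; rewrite /ball/= ltr_pdivlMr// => ts.
  have [st|/ltW st] := leP s t.
    apply: le_lt_trans (lipu s t st) _; rewrite mulrC.
    by rewrite ger0_norm ?subr_ge0 in ts.
  rewrite distrC; apply: le_lt_trans (lipu t s st) _; rewrite mulrC.
  by rewrite distrC ger0_norm ?subr_ge0 in ts.
apply/cvgrPdist_lt => q0 q00; apply: contrapT => ncvg.
(* As q <= r, an agent in the ring is between q / 4 and 3 q / 4 <= r away from every agent within q
   / 8 of [z], so these pairs interact at rate at least [Delta]. *)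
pose q := Num.min q0 r.
have q_gt0 : 0 < q by rewrite lt_min q00 r0.
have qq0 : q <= q0 by rewrite ge_min lexx.
have qr : q <= r by rewrite ge_min lexx orbT.
have far M : exists2 t, M < t & q <= u t.
  apply: contrapT => h; apply: ncvg; exists M; split; first exact: num_real.
  move=> t Mt; rewrite distrC ltNge; apply/negP => qt; apply: h; exists t => //.
  exact: le_trans qt.
have q80 : 0 < q / 8 by rewrite divr_gt0.
have [c c0 [N0 HN0]] := cz _ q80.
(* During a time [dl] the distance to [z] changes by at most q / 8, so from the value q / 2 it stays
   in the ring. *)
pose dl := q / 8 / W1; have dl0 : 0 < dl by rewrite divr_gt0.
pose k0 := Delta * (q / 4) ^+ 2 * c.
have k00 : 0 < k0 by rewrite !mulr_gt0// ?exprn_gt0// divr_gt0.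
have strain_ge s : N0 <= s -> 3 / 8 * q <= u s <= 5 / 8 * q ->
    k0 <= strain s a.
  move=> N0s /andP[us1 us2].
  apply: le_trans (_ : Delta * (q / 4) ^+ 2 * mass (nearby z (q / 8)) s <= _).
    by rewrite ler_pM2l ?HN0// mulr_gt0// exprn_gt0// divr_gt0.
  have mN := measurable_nearby z (q / 8).
  rewrite /mass -RintegralZl//; last exact: (mass_integrable flow s mN).
  have Dq0 : 0 <= Delta * (q / 4) ^+ 2 by rewrite mulr_ge0 ?sqr_ge0// ltW.
  apply: le_Rintegral => //.
  - apply: (flow_bounded_integrable flow (M := Delta * (q / 4) ^+ 2)).
      apply: measurable_funM => //.
      have mXs : measurable_fun setT (X s).
        exact: (flow_measurable_comp flow).
      by apply: measurableT_comp => //; exact: measurable_indic.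
    move=> b; rewrite indicE normrM (ger0_norm Dq0) ler_piMr//.
    by case: (_ \in _); rewrite ?normr1 ?normr0.
  - exact: (pull_integrable flow).
  move=> b _; rewrite indicE.
  have [Xb|_] := boolP (X s b \in _); last by rewrite mulr0 (pull_ge0 flow).
  move: Xb; rewrite inE /nearby/= in_itv/= => /andP[? ?].
  rewrite mulr1 /pull -mulrA.
  have dist : q / 4 <= `|X s a - X s b| <= r.
    move: us1 us2; rewrite /u; have [az|az] := leP 0 (X s a - z).
      rewrite ger0_norm// => ? ?.
      by rewrite ger0_norm; [apply/andP; split|]; lra.
    rewrite ltr0_norm// => ? ?.
    by rewrite ler0_norm; [apply/andP; split|]; lra.
  have /andP[dist1 dist2] := dist.
  apply: ler_pM; [exact: ltW|exact: sqr_ge0|exact: Gamma|].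
  rewrite -expr2 -[leRHS]real_normK ?num_real// ler_pXn2r ?nnegrE//.
  by rewrite divr_ge0// ltW.
(* Recurrence brings the agent within q / 4 of [z] after both [T] and [N0], and later it is at
   distance at least q. In between it passes q / 2, at [t2], and it spends the interval from [t2] to
   t2 + dl in the ring, at a cost of at least k0 * dl. *)
have step T : 0 <= T -> exists2 T', T <= T' & total T a + k0 * dl <= total T' a.
  move=> T0; pose M := Num.max T N0.
  have [n] : exists n : nat, n.+1%:R^-1 < q / 4.
    have q40 : 0 < q / 4 by rewrite divr_gt0.
    exists (Num.truncn (q / 4)^-1); rewrite invf_plt ?posrE//.
    exact: truncnS_gt.
  move=> nq; have [k kM ku] := rec n (Num.truncn M).+1.
  have {}ku : u k%:R < q / 4 by exact: lt_trans nq.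
  have {}kM : M <= k%:R.
    by apply: le_trans (ltW (truncnS_gt M)) _; rewrite ler_nat.
  have [t1 kt1 qt1] := far k%:R.
  have [t2] : exists2 t2, t2 \in `[k%:R, t1] & u t2 = q / 2.
    apply: IVT; [exact: ltW|exact: continuous_subspaceT|].
    by rewrite ge_min le_max; apply/andP; split; apply/orP; [left|right]; lra.
  rewrite in_itv/= => /andP[kt2 t2t1] ut2.
  move: kM; rewrite /M ge_max => /andP[TK NK].
  exists (t2 + dl); first by lra.
  have h1 : total T a <= total t2 a by apply: total_nd => //; lra.
  have h2 : 0 <= t2 by lra.
  have h3 : t2 <= t2 + dl by lra.
  rewrite (total_add a h2 h3) lerD//.
  rewrite [X in k0 * X](_ : dl = t2 + dl - t2); last by rewrite addrC addKr.
  apply: Rintegral_segment_ge => //.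
  move=> s /andP[t2s sdl]; apply: strain_ge; first by lra.
  have := lipu t2 s t2s.
  have : W1 * (s - t2) <= q / 8.
    apply: le_trans (_ : W1 * dl <= _); first by rewrite ler_pM2l//; lra.
    by rewrite /dl mulrC divfK// gt_eqF.
  rewrite ut2 => h4 /le_trans/(_ h4); rewrite ler_norml => /andP[? ?].
  by apply/andP; split; lra.
have steps (m : nat) : exists2 T, 0 <= T & m%:R * (k0 * dl) <= total T a.
  elim: m => [|m [T T0 HT]].
    exists 0 => //; rewrite mul0r; apply: Rintegral_ge0 => t _.
    exact: strain_ge0.
  have [T' TT' HT'] := step T T0; exists T'; first exact: le_trans TT'.
  by apply: le_trans HT'; rewrite -natr1 mulrDl mul1r lerD2r.
have kd0 : 0 < k0 * dl by rewrite mulr_gt0.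
(* This many excursions carry [total] beyond [C]; rounding [T] up to an integer contradicts
   [totC]. *)
have [T T0 HT] := steps (Num.truncn (C / (k0 * dl))).+1.
have : C < (Num.truncn (C / (k0 * dl))).+1%:R * (k0 * dl).
  by rewrite -ltr_pdivrMr// truncnS_gt.
have TT : T <= (Num.truncn T).+1%:R by exact/ltW/truncnS_gt.
have := totC (Num.truncn T).+1; have := total_nd a T0 TT; lra.
Qed.

End crossing.

(** * Finitely many limits *)

Section flow_limit.
Context d (A : measurableType d) (R : realType)
  (mu : {sigma_finite_measure set A -> \bar R}) (D : set A)
  (K : R -> A -> A -> R) (X : R -> A -> R) (W : R).
Hypothesis flow : averaging_flow mu D K X W.
Variables r Delta : R.
Hypothesis r0 : 0 < r.
Hypothesis Delta0 : 0 < Delta.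
Hypothesis Gamma : forall t a b, `|X t a - X t b| <= r -> Delta <= K t a b.

Local Notation limit_points := (limit_points mu D X).

Let limit_points_separated z z' : limit_points z -> limit_points z' ->
  z != z' -> r <= `|z - z'|.
Proof.
move=> [_ cz] [_ cz'] zz'.
have sep u v :=
  @cluster_separated _ _ _ _ _ _ _ _ flow r Delta Delta0 Gamma u v.
move: zz'; rewrite neq_lt => /orP[zz'|z'z].
  by rewrite distrC (le_trans (sep _ _ cz cz' zz'))// ler_norm.
by rewrite (le_trans (sep _ _ cz' cz z'z))// ler_norm.
Qed.

(** A cell [n r, (n + 1) r) holds at most one limit point, since two would be closer than r, and
    [0, 1] meets finitely many cells. *)
Lemma finite_limit_points : finite_set limit_points.
Proof.
(* The value [None] outside [limit_points] keeps [cell] injective on the preimage of [B]. *)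
pose cell z := if z \in limit_points then Some (Num.truncn (z / r)) else None.
pose B := [set Some n | n in `I_(Num.truncn r^-1).+1].
apply: (sub_finite_set (B := cell @^-1` B)).
  move=> z Zz; have [/andP[z0 z1] _] := Zz.
  rewrite /preimage /= /cell mem_set//; exists (Num.truncn (z / r)) => //=.
  by rewrite ltnS; apply: le_truncn; rewrite ler_piMl// invr_ge0 ltW.
apply: finite_preimage; last exact/finite_image/finite_II.
move=> u v; rewrite !inE /preimage /= /cell.
case: ifPn => [/set_mem Zu _|_ [? _ //]].
case: ifPn => [/set_mem Zv _|_ [? _ //]] [uv].
apply/eqP/negPn/negP => neq; have := limit_points_separated Zu Zv neq.
apply/negP; rewrite -ltNge.
have itv z : limit_points z -> (Num.truncn (z / r))%:R * r <= z <
    (Num.truncn (z / r)).+1%:R * r.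
  move=> [/andP[z0 _] _]; rewrite -ler_pdivlMr// -ltr_pdivrMr//.
  by rewrite truncnS_gt andbT truncn_le// divr_ge0// ltW.
have := itv u Zu; have := itv v Zv; rewrite uv -natr1 mulrDl mul1r.
by move=> /andP[? ?] /andP[? ?]; rewrite ltr_norml; apply/andP; split; lra.
Qed.

Theorem averaging_flow_cvg : exists (k : nat) (z : 'I_k -> R),
  [/\ forall i, 0 <= z i <= 1,
      forall i j, i != j -> r <= `|z i - z j| &
      {ae mu, forall a, D a -> exists i, X t a @[t --> +oo] --> z i}].
Proof.
have /finite_seqP[s0 Ls0] := finite_limit_points.
(* Without repetitions, distinct indices give distinct points, as the separation requires. *)
pose s := undup s0.
have Ls z : limit_points z <-> z \in s by rewrite Ls0 mem_undup.
have Zi (i : 'I_(size s)) : limit_points (nth 0 s i) by apply/Ls/mem_nth.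
exists (size s), (fun i => nth 0 s i); split.
- by move=> i; have [] := Zi i.
- move=> i j ij; apply: limit_points_separated => //.
  by rewrite nth_uniq// undup_uniq.
have := ae_and (ae_recurrent flow) (ae_bounded_strain flow).
move=> /ae_imply; apply => a [rec bnd] Da.
have {}rec := rec Da; have [C HC] := bnd Da.
suff [i Hi] : exists i : 'I_(size s), forall n N : nat,
    exists2 k : nat, (N <= k)%N & `|X k%:R a - nth 0 s i| < n.+1%:R^-1.
  exists i; apply: (recurrent_cluster_cvg flow r0 Delta0 Gamma HC) => //.
  by have [] := Zi i.
(* Pigeonhole: if every point failed beyond thresholds of its own, recurrence at the largest
   thresholds would contradict one of these failures. *)
apply: contrapT => /forallNP H.
have {}H (i : 'I_(size s)) : exists p : nat * nat, forall k : nat,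
    (p.2 <= k)%N -> p.1.+1%:R^-1 <= `|X k%:R a - nth 0 s i|.
  have /existsNP[n /existsNP[N HN]] := H i; exists (n, N) => k /= Nk.
  by rewrite leNgt; apply/negP => lt; apply: HN; exists k.
have [p Hp] := choice H.
have [k kN [z /Ls zs kz]] := rec (\max_i (p i).1) (\max_i (p i).2).
have zi : (index z s < size s)%N by rewrite index_mem.
pose i := Ordinal zi.
have ki : ((p i).2 <= k)%N.
  by apply: leq_trans kN; exact: (leq_bigmax (F := fun i => (p i).2)).
have := Hp i k ki; rewrite /= nth_index//; apply/negP; rewrite -ltNge.
apply: lt_le_trans kz _; rewrite lef_pV2 ?posrE// ler_nat ltnS.
exact: (leq_bigmax (F := fun i => (p i).1)).
Qed.

End flow_limit.

(** * Joint measurability and the maximum principle *)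

Lemma measurable_lipschitz_time d (A : measurableType d) (R : realType)
    (X : R -> A -> R) (W : R) :
  (forall t, measurable_fun setT (X t)) ->
  (forall a s t, s <= t -> `|X t a - X s a| <= W * (t - s)) ->
  measurable_fun setT (fun p : measurableTypeR R * A => X p.1 p.2).
Proof.
move=> mX lipX.
(* Time is rounded down to a multiple of 1 / (n + 1). Each [h n] is measurable as a countable
   patchwork of the [X t], and the Lipschitz bound in time makes it converge to [X] pointwise. *)
pose h (n : nat) (p : measurableTypeR R * A) :=
  X ((Num.floor (n.+1%:R * (p.1 : R)))%:~R / n.+1%:R) p.2.
apply: (measurable_fun_cvg (h := h)).
  move=> n _ B mB; rewrite setTI.
  have -> : h n @^-1` B = \bigcup_(k : int)
      (`[(k%:~R / n.+1%:R : R), ((k + 1)%:~R / n.+1%:R : R)[%classic `*`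
        (X (k%:~R / n.+1%:R) @^-1` B)).
    have n0 : (0 : R) < n.+1%:R by [].
    apply/seteqP; split=> [[t a] /= Bh|[t a] [k _] [/=]].
      exists (Num.floor (n.+1%:R * t)) => //; split => //=.
      rewrite in_itv/= ler_pdivrMr// ltr_pdivlMr// (mulrC t).
      exact: floor_itv.
    rewrite in_itv/= ler_pdivrMr// ltr_pdivlMr// (mulrC t) => tk Xk.
    by rewrite /h /= (floor_def tk).
  apply: countable_bigcupT_measurable => //.
  move=> k; apply: measurableX => //.
  by rewrite -[X in measurable X]setTI; exact: mX.
move=> [t a] _ /=; apply/cvgrPdist_lt => e e0.
have W0 : 0 <= W.
  have := lipX a 0 1 ler01; rewrite subr0 mulr1; exact: le_trans.
have We : 0 < e / (W + 1) by rewrite divr_gt0// ltr_wpDl.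
have /cvgrPdist_lt/(_ _ We) := @cvg_harmonic R.
apply: filterS => n; rewrite sub0r normrN ger0_norm ?invr_ge0// => ne.
have n0 : (0 : R) < n.+1%:R by [].
have /andP[f1 f2] := floor_itv (n.+1%:R * t : R).
have le : (Num.floor (n.+1%:R * t))%:~R / n.+1%:R <= t.
  by rewrite ler_pdivrMr// [leRHS]mulrC.
apply: le_lt_trans (lipX a _ _ le) _.
have gap : t - (Num.floor (n.+1%:R * t))%:~R / n.+1%:R <= n.+1%:R^-1.
  rewrite lerBlDr -[X in X + _]mul1r -mulrDl ler_pdivlMr// [leLHS]mulrC.
  by apply/ltW; move: f2; rewrite intrD addrC.
apply: le_lt_trans (ler_wpM2l W0 gap) _.
have ninv : (0 : R) < n.+1%:R^-1 by rewrite invr_gt0.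
have W1 : 0 < W + 1 by lra.
move: ne; rewrite /harmonic /= ltr_pdivlMr// => ne.
by apply: le_lt_trans ne; rewrite mulrC ler_pM2l ?invr_gt0// lerDl.
Qed.

Lemma is_derive_expRM (R : realType) (W t : R) :
  is_derive t 1 (fun s : R => expR (W * s)) (W * expR (W * t)).
Proof.
have dW : is_derive t 1 (fun s : R => W * s) W.
  have := is_deriveZ W (is_derive_id t (1 : R)).
  by rewrite /GRing.scale/= mulr1.
have de := is_derive_expR (W * t).
rewrite mulrC; exact: (is_derive1_comp (f := expR) (g := fun s : R => W * s)).
Qed.

Lemma expRM_lipschitz (R : realType) (W T s t : R) : 0 <= W -> s <= t ->
  t <= T -> `|expR (W * t) - expR (W * s)| <= W * expR (W * T) * (t - s).
Proof.
move=> W0 st tT.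
have ce : {within `[s, t], continuous (fun s : R => expR (W * s))}.
  apply: continuous_subspaceT; exact: (derive_continuous (is_derive_expRM W)).
have [c] := MVT_segment st (fun u _ => is_derive_expRM W u) ce.
rewrite in_itv/= => /andP[sc ct] ->.
have ts : 0 <= t - s by rewrite subr_ge0.
rewrite normrM (ger0_norm ts) ler_wpM2r// ger0_norm; last first.
  by rewrite mulr_ge0// expR_ge0.
by rewrite ler_wpM2l// ler_expR ler_wpM2l// (le_trans ct).
Qed.

(* If the drift of each agent is at most [W * (S - y)] for every upper bound
   [S], then [S - y] decays at most exponentially, so that
   [S - (S - c) * exp (- W T)] is again an upper bound; the supremum being the
   least one, it is at most [c]. *)
Lemma maximum_principle (R : realType) (I : Type) (y v : R -> I -> R)
    (T W L c : R) : 0 <= T -> 0 <= W ->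
  (forall i s t, 0 <= s -> s <= t -> t <= T ->
    `|y t i - y s i| <= L * (t - s)) ->
  (forall i, {ae (@lebesgue_measure R), forall t : R, 0 < t < T ->
    is_derive t 1 (y^~ i) (v t i)}) ->
  (exists M, forall t i, 0 <= t <= T -> y t i <= M) ->
  (forall i, y 0 i <= c) ->
  (forall S, (forall t i, 0 <= t <= T -> y t i <= S) ->
    forall t i, 0 <= t <= T -> v t i <= W * (S - y t i)) ->
  forall t i, 0 <= t <= T -> y t i <= c.
Proof.
move=> T0 W0 lipy dy [M yM] yc vS t0 i0 t0T; rewrite leNgt; apply/negP => cy.
pose E := [set y p.1 p.2 | p in [set p | 0 <= p.1 <= T]].
have E0 : E (y t0 i0) by exists (t0, i0).
have supE : has_sup E.
  by split; [exists (y t0 i0) | exists M => _ [[t i] /= tT <-]; exact: yM].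
pose S := sup E.
have yS t i : 0 <= t <= T -> y t i <= S.
  by move=> tT; apply: ub_le_sup; [case: supE | exists (t, i)].
have cS : 0 < S - c by rewrite subr_gt0 (lt_le_trans cy)// yS.
have dl0 : 0 < (S - c) * expR (- (W * T)) by rewrite mulr_gt0// expR_gt0.
have [_ [[t i] /= /andP[tge0 tT] <-]] := sup_adherent dl0 supE.
rewrite -/S; apply/negP; rewrite -leNgt.
(* With the integrating factor, v <= W * (S - y) says that the derivative [q] of [F] is
   nonpositive. *)
pose F s := (y s i - S) * expR (W * s).
pose q s := v s i * expR (W * s) + (y s i - S) * (W * expR (W * s)).
(* A bound of |y - S| along the path; it makes [F] Lipschitz, so that the sign of its derivative
   almost everywhere decides its monotonicity. *)
pose B := `|y 0 i - S| + `|L| * T.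
have yB s : 0 <= s -> s <= T -> `|y s i - S| <= B.
  move=> s0 sT.
  rewrite (_ : _ - S = (y 0 i - S) + (y s i - y 0 i)); last by ring.
  apply: le_trans (ler_normD _ _) _; rewrite lerD2l.
  apply: le_trans (lipy i 0 s (lexx _) s0 sT) _; rewrite subr0.
  apply: le_trans (ler_wpM2r s0 (ler_norm L)) _; exact: ler_wpM2l.
have lipF a b : 0 <= a -> a <= b -> b <= t ->
    `|F b - F a| <= (L * expR (W * T) + B * (W * expR (W * T))) * (b - a).
  move=> a0 ab bt; have bT : b <= T by exact: le_trans tT.
  rewrite (_ : F b - F a = (y b i - y a i) * expR (W * b) +
    (y a i - S) * (expR (W * b) - expR (W * a))); last by rewrite /F; ring.
  apply: le_trans (ler_normD _ _) _; rewrite [leRHS]mulrDl lerD// normrM.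
    rewrite [leRHS]mulrAC ler_pM//; first exact: lipy.
    by rewrite ger0_norm ?expR_ge0// ler_expR ler_wpM2l.
  rewrite -[leRHS]mulrA ler_pM//; first by apply: yB => //; lra.
  exact: expRM_lipschitz.
have : F t - F 0 <= 0 * (t - 0).
  apply: (ac_le_derive (q := q)) => //; first exact: lipschitz_ac lipF.
  apply: (ae_imply (dy i)) => s dys /andP[s0 st]; split.
    have dyi : is_derive s 1 (y^~ i) (v s i).
      by apply: dys; rewrite s0 (lt_le_trans st).
    have dyS : is_derive s 1 (fun s => y s i - S) (v s i).
      have := is_deriveB dyi (is_derive_cst S s (1 : R)).
      by rewrite subr0.
    have := is_deriveM dyS (is_derive_expRM W s).
    move=> h; apply: (is_derive_eq h).
    by rewrite /q /GRing.scale/= addrC [in LHS]mulrC.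
  rewrite /q mulrCA mulrA -mulrDl mulr_le0_ge0 ?expR_ge0//.
  have := vS S yS s i; rewrite (ltW s0) (ltW (lt_le_trans st tT)) => /(_ isT).
  lra.
rewrite mul0r /F mulr0 expR0 mulr1 subr_le0 => h.
have eW : expR (- (W * t)) * expR (W * t) = 1.
  by rewrite -expRD addNr expR0.
have h1 : (S - c) * expR (- (W * t)) <= S - y t i.
  have -> : S - y t i = expR (- (W * t)) * ((S - y t i) * expR (W * t)).
    by rewrite mulrCA eW mulr1.
  rewrite [leLHS]mulrC ler_wpM2l ?expR_ge0//.
  have := yc i; lra.
have : (S - c) * expR (- (W * T)) <= (S - c) * expR (- (W * t)).
  by rewrite ler_pM2l// ler_expR lerN2 ler_wpM2l.
lra.
Qed.

(** A null set of the completed measure has outer measure zero, so it lies in a Borel null set. *)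
Lemma ae_completed_lebesgue (R : realType) (P : R -> Prop) :
  {ae (@completed_lebesgue_measure R), forall t, P t} ->
  {ae (@lebesgue_measure R), forall t, P t}.
Proof.
move=> [N [_ N0 NP]]; apply/negligible_outer_measure.
apply/eqP; rewrite eq_le outer_measure_ge0 andbT -N0.
exact: le_outer_measure.
Qed.

(** * The solution as an averaging flow *)

Section weighted_dynamics.
Context (R : realType) (w : R -> R -> R -> R -> R -> R) (x : R -> R -> R).
Hypothesis hw : weight_function w.
Hypothesis hx : is_solution w x.
Hypothesis hsym : weight_symmetric w x.

Local Notation mu := (@completed_lebesgue_measure R).
Let I : set (lebesgueR R) := `[0, 1]%classic.

Let mI : measurable I.
Proof. by apply: sub_caratheodory; exact: measurable_itv. Qed.

Let muI : mu I = 1%E.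
Proof.
have := lebesgue_measure_itvcc (@ler01 R); rewrite subr0; exact.
Qed.

Let muI_lty : (mu I < +oo)%E. Proof. by rewrite muI ltry. Qed.

Let measurable_val : measurable_fun setT (id : lebesgueR R -> R).
Proof.
by move=> _ B mB; rewrite setTI; apply: sub_caratheodory; exact: mB.
Qed.

Let measurable_weight_domain : measurable (@weight_domain R).
Proof.
have -> : @weight_domain R =
    `[0, +oo[ `*` `[0, 1] `*` `[0, 1] `*` setT `*` setT.
  apply/seteqP; split=> [[[[[t a] b] y] z] /= [t0 a01 b01]|
    [[[[t a] b] y] z] /= [[[[t0 a01] b01] _] _]].
    by rewrite !in_itv/= andbT; do !split.
  by move: t0 a01 b01; rewrite !in_itv/= andbT.
by do 4 (apply: measurableX => //).
Qed.

Lemma measurable_weight_comp d (T : measurableType d) (t a b y z : T -> R) :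
  (forall p, 0 <= t p) -> (forall p, 0 <= a p <= 1) ->
  (forall p, 0 <= b p <= 1) ->
  measurable_fun setT t -> measurable_fun setT a -> measurable_fun setT b ->
  measurable_fun setT y -> measurable_fun setT z ->
  measurable_fun setT (fun p => w (t p) (a p) (b p) (y p) (z p)).
Proof.
move=> t0 a01 b01 mt ma mb my mz.
apply: (measurable_comp (F := @weight_domain R)
  (g := fun p => (t p, a p, b p, y p, z p))) (weight_measurable hw) _ => //.
  by move=> _ [p _ <-]; split.
by do 4 (apply: measurable_fun_pair => //).
Qed.

Let clamp (a : R) : R := if 0 <= a <= 1 then a else 0.

Let clamp01 a : 0 <= clamp a <= 1.
Proof. by rewrite /clamp; case: ifP => // _; rewrite lexx ler01. Qed.

Let clampE a : 0 <= a <= 1 -> clamp a = a.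
Proof. by rewrite /clamp => ->. Qed.

Let pos (t : R) : R := Num.max 0 t.

Let pos_ge0 t : 0 <= pos t. Proof. by rewrite le_max lexx. Qed.

Let posE t : 0 <= t -> pos t = t.
Proof. by move=> t0; exact/max_idPr. Qed.

(* Negative times are frozen at time 0 and the agents outside [0, 1] copy agent
   0, so that the hypotheses on x and w hold at all times for all agents. *)
Definition ext_state (t : R) (a : lebesgueR R) : R := x (pos t) (clamp a).

Definition ext_weight (t : R) (a b : lebesgueR R) : R :=
  w (pos t) (clamp a) (clamp b) (ext_state t a) (ext_state t b).

Local Notation X := ext_state.
Local Notation K := ext_weight.
Local Notation velocity := (drift mu I K X).

(** Outside [I] the composite is the constant f 0, so subtracting f 0 leaves an extension by
    zero. *)
Let clamp_restrict (f : R -> R) : measurable_fun I (f : lebesgueR R -> R) ->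
  measurable_fun setT (fun a : lebesgueR R => f (clamp a)).
Proof.
move=> mf.
have mg : measurable_fun I (fun a : lebesgueR R => f a - f 0).
  exact: measurable_funB.
have -> : (fun a : lebesgueR R => f (clamp a)) =
    (fun a => ((fun a : lebesgueR R => f a - f 0) \_ I) a + f 0).
  apply/funext => a; rewrite patchE /clamp.
  have -> : (a \in I) = (0 <= (a : R) <= 1).
    by apply/idP/idP; rewrite inE /I /= in_itv.
  by case: ifP => _; [rewrite subrK|rewrite add0r].
apply: measurable_funD; last exact: measurable_cst.
exact: ((measurable_restrictT _ mI).1 mg).
Qed.

Let measurable_clamp : measurable_fun setT (clamp : lebesgueR R -> R).
Proof.
by apply: (clamp_restrict (f := id)); exact: measurable_funTS.
Qed.

Let measurable_state t : measurable_fun setT (X t).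
Proof. by apply: clamp_restrict; exact: (solution_measurable hx). Qed.

Let W_ex : exists W, forall t a b, 0 <= K t a b <= W.
Proof.
have [W HW] := weight_bounded hw; exists W => t a b.
by rewrite (weight_ge0 hw) ?HW//; split.
Qed.

Let velocityE t a : 0 <= t -> 0 <= a <= 1 ->
  velocity t a = \int[mu]_(b in `[0, 1]%classic)
           (w t a b (x t a) (x t b) * (x t b - x t a)).
Proof.
move=> t0 a01; apply: eq_Rintegral => b; rewrite inE /I /= in_itv/= => b01.
by rewrite /K /X posE// !clampE.
Qed.

(** Positive times only: freezing the past may create a corner at time 0. *)
Let derive_state a : {ae (@lebesgue_measure R), forall t : R, 0 < t ->
  is_derive t 1 (X^~ a) (velocity t a)}.
Proof.
apply: (ae_imply (ae_completed_lebesgue (solution_eq hx (clamp01 a)))).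
move=> t dt t0.
have -> : velocity t a = velocity t (clamp a).
  apply: eq_Rintegral => b _; by rewrite /K /X (clampE (clamp01 a)).
rewrite velocityE ?clamp01 ?ltW//.
apply: near_eq_is_derive (dt (ltW t0)).
apply: filterS (lt_le_nbhsr t0) => s s0.
by rewrite /X posE.
Qed.

Let measurable_weight_pull t a :
  measurable_fun setT (fun b => K t a b * (X t b - X t a)).
Proof.
apply: measurable_funM; last exact: measurable_funB.
by apply: (measurable_weight_comp (T := lebesgueR R)
  (b := fun b => clamp b)) => // b; exact: clamp01.
Qed.

Let state_bounded T : 0 <= T ->
  exists M, forall t a, 0 <= t <= T -> `|X t a| <= M.
Proof.
move=> T0; have [M HM] := solution_bounded hx T0; exists M => t a tT.
have /andP[t0 _] := tT.
by rewrite /X posE//; apply: HM.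
Qed.

Let velocity_integrable t a :
  mu.-integrable I (EFin \o (fun b => K t a b * (X t b - X t a))).
Proof.
have [W HW] := W_ex; have [M HM] := state_bounded (pos_ge0 t).
have XM b : `|X t b| <= M.
  have -> : X t b = X (pos t) b by rewrite /X (posE (pos_ge0 t)).
  by apply: HM; rewrite pos_ge0 lexx.
apply: (@bounded_integrable _ _ _ _ _ _ (W * (M + M))).
- exact: mI.
- exact: muI_lty.
- by apply: measurable_funTS; exact: measurable_weight_pull.
move=> b _; have /andP[k0 kW] := HW t a b.
rewrite normrM (ger0_norm k0) ler_pM//.
by apply: le_trans (ler_normB _ _) _; exact: lerD.
Qed.

(** No agent is pulled beyond the upper bound [S], and the total rate is at most [W] because the
    agents have mass 1. This is the drift condition of [maximum_principle]. *)
Let velocity_le W S t a : (forall b c, 0 <= K t b c <= W) ->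
  (forall b, X t b <= S) -> velocity t a <= W * (S - X t a).
Proof.
move=> HW XS; rewrite -[leRHS]mulr1.
have -> : W * (S - X t a) * 1 = \int[mu]_(b in I) (W * (S - X t a)).
  by rewrite Rintegral_cst// [X in fine X]muI.
apply: le_Rintegral => //.
  by apply: (@bounded_integrable _ _ _ _ _ _ `|W * (S - X t a)|).
move=> b _; have /andP[k0 kW] := HW a b.
have Sa : 0 <= S - X t a by rewrite subr_ge0.
apply: le_trans (_ : K t a b * (S - X t a) <= _).
  by rewrite ler_wpM2l// lerD2r.
by rewrite ler_wpM2r.
Qed.

Let velocity_ge W S t a : (forall b c, 0 <= K t b c <= W) ->
  (forall b, S <= X t b) -> - velocity t a <= W * (X t a - S).
Proof.
move=> HW XS; rewrite lerNl -mulrN opprB -[leLHS]mulr1.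
have -> : W * (S - X t a) * 1 = \int[mu]_(b in I) (W * (S - X t a)).
  by rewrite Rintegral_cst// [X in fine X]muI.
apply: le_Rintegral => //.
  by apply: (@bounded_integrable _ _ _ _ _ _ `|W * (S - X t a)|).
move=> b _; have /andP[k0 kW] := HW a b.
have Sa : 0 <= X t a - S by rewrite subr_ge0.
rewrite -lerN2 -!mulrN !opprB.
apply: le_trans (_ : K t a b * (X t a - S) <= _).
  by rewrite ler_wpM2l// lerD2l lerN2.
by rewrite ler_wpM2r.
Qed.

Let state_ac T a : 0 <= T -> absolutely_continuous_on 0 T (X^~ a).
Proof.
move=> T0 e e0; have [d d0 Hd] := solution_ac hx (clamp01 a) T0 e0.
exists d => // n u v uv triv len; rewrite /X.
have := Hd n u v uv triv len.
congr (_ < _); apply: eq_bigr => i _; have [u0 uvi _] := uv i.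
by rewrite !posE// (le_trans u0).
Qed.

Let state_lipschitz_on W T : 0 <= T ->
  (forall t a, 0 < t < T -> `|velocity t a| <= W) ->
  forall a s t, 0 <= s -> s <= t -> t <= T -> `|X t a - X s a| <= W * (t - s).
Proof.
move=> T0 vW a; apply: (ac_lipschitz (q := velocity ^~ a)).
  exact: state_ac.
apply: (ae_imply (derive_state a)) => t dt tT; split; last exact: vW.
by apply: dt; case/andP: tT.
Qed.

(** The maximum principle asks for Lipschitz paths. On a bounded time interval the crude bound [M]
    limits the velocity to [W * (M + M)], which suffices; the principle then applies to [X] with
    bound 1 and to its opposite with bound 0. *)
Lemma ext_state_itv t a : 0 <= X t a <= 1.
Proof.
have [W HW] := W_ex.
have W0 : 0 <= W by have /andP[k0 kW] := HW 0 0 0; exact: le_trans kW.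
pose T := pos t; have T0 : 0 <= T := pos_ge0 t.
have [M HM] := state_bounded T0.
have Mge0 : 0 <= M by rewrite (le_trans (normr_ge0 _) (HM 0 0 _))// lexx T0.
have vle s b : 0 <= s <= T -> `|velocity s b| <= W * (M + M).
  move=> sT.
  have XM c : - M <= X s c <= M by rewrite -ler_norml HM.
  rewrite ler_norml; apply/andP; split.
    rewrite lerNl; apply: le_trans (velocity_ge b (HW s) (S := - M) _) _.
      by move=> c; have /andP[] := XM c.
    by rewrite opprK ler_wpM2l// lerD2r; have /andP[] := XM b.
  apply: le_trans (velocity_le b (HW s) (S := M) _) _.
    by move=> c; have /andP[] := XM c.
  by rewrite ler_wpM2l// lerD2l lerNl; have /andP[] := XM b.
have vlt s b : 0 < s < T -> `|velocity s b| <= W * (M + M).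
  by move=> /andP[s0 sT]; apply: vle; rewrite !ltW.
have lipX := state_lipschitz_on T0 vlt.
have tT : 0 <= T <= T by rewrite T0 lexx.
have -> : X t a = X T a by rewrite /X (posE T0).
have X0 b : 0 <= X 0 b <= 1.
  by rewrite /X posE//; exact: (solution_init hx).
apply/andP; split; last first.
  apply: (maximum_principle (y := X) (v := velocity) T0 W0) tT => //.
  - by move=> b s u; exact: lipX.
  - move=> b; apply: (ae_imply (derive_state b)) => s ds /andP[s0 _]; exact: ds.
  - by exists M => s b sT; apply: le_trans (ler_norm _) _; exact: HM.
  - by move=> b; have /andP[] := X0 b.
  - move=> S XS s b sT; apply: velocity_le => // c; exact: XS.
rewrite -[leRHS]opprK -[leLHS]oppr0 lerN2.
apply: (maximum_principle (y := fun s b => - X s b)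
  (v := fun s b => - velocity s b) T0 W0) tT => //.
- move=> b s u s0 su uT; rewrite -opprD normrN; exact: (lipX b s u).
- move=> b; apply: (ae_imply (derive_state b)) => s ds /andP[s0 _].
  exact: (is_deriveN (ds s0)).
- exists M => s b sT; apply: le_trans (ler_norm _) _.
  by rewrite normrN; exact: HM.
- by move=> b; have /andP[X0b _] := X0 b; rewrite oppr_le0.
- move=> S XS s b sT.
  rewrite (_ : S - - X s b = X s b - - S); last by rewrite !opprK addrC.
  by apply: velocity_ge => // c; rewrite lerNl; exact: XS.
Qed.

(** Once the states lie in [0, 1], the velocity is at most [W] at all times, so the Lipschitz
    constant no longer depends on the horizon, and joint measurability follows from it. *)
Lemma ext_averaging_flow : exists W, averaging_flow mu I K X W.
Proof.
have [W HW] := W_ex; exists W.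
have W0 : 0 <= W by have /andP[k0 kW] := HW 0 0 0; exact: le_trans kW.
have vle s b : `|velocity s b| <= W.
  rewrite ler_norml; apply/andP; split.
    rewrite lerNl; apply: le_trans (velocity_ge b (HW s) (S := 0) _) _.
      by move=> c; have /andP[] := ext_state_itv s c.
    by rewrite subr0 ler_piMr//; have /andP[] := ext_state_itv s b.
  apply: le_trans (velocity_le b (HW s) (S := 1) _) _.
    by move=> c; have /andP[] := ext_state_itv s c.
  by rewrite ler_piMr// gerBl; have /andP[] := ext_state_itv s b.
have lipX a s t : s <= t -> `|X t a - X s a| <= W * (t - s).
  move=> st; have st' : pos s <= pos t by rewrite ge_max pos_ge0 le_max st orbT.
  have := state_lipschitz_on (pos_ge0 t) (fun s b _ => vle s b) a (pos_ge0 s)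
    st' (lexx _).
  rewrite {1}/X {1}/X (posE (pos_ge0 t)) (posE (pos_ge0 s)).
  move/le_trans; apply; rewrite ler_wpM2l//.
  rewrite /pos; case: (leP 0 s) => ?; case: (leP 0 t) => ?; lra.
have mX := measurable_lipschitz_time measurable_state lipX.
split => //.
- have m1 : measurable_fun setT
      (fun p : measurableTypeR R * lebesgueR R * lebesgueR R => p.1.1).
    exact: measurableT_comp.
  have m2 : measurable_fun setT
      (fun p : measurableTypeR R * lebesgueR R * lebesgueR R => p.1.2).
    exact: measurableT_comp.
  apply: (measurable_weight_comp
    (T := (measurableTypeR R * lebesgueR R * lebesgueR R)%type)
    (t := fun p => pos p.1.1) (a := fun p => clamp p.1.2)
    (b := fun p => clamp p.2) (y := fun p => X p.1.1 p.1.2)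
    (z := fun p => X p.1.1 p.2)) => //.
  + exact: measurable_maxr.
  + exact: (measurableT_comp measurable_clamp m2).
  + exact: (measurableT_comp measurable_clamp measurable_snd).
  + exact: (measurableT_comp mX measurable_fst).
  + have := measurable_fun_pair m1 (@measurable_snd _ _
      (measurableTypeR R * lebesgueR R)%type (lebesgueR R)).
    exact: (@measurableT_comp _ _ _ _ _ _ _ _ (fun p => (p.1.1, p.2)) mX).
- exact: ext_state_itv.
- by move=> t a b; have /andP[] := HW t a b.
- by move=> t a b; have /andP[] := HW t a b.
- by move=> t a b; apply: hsym.
Qed.

Lemma ext_weight_Gamma r Delta : weight_Gamma r Delta w x ->
  forall t a b, `|X t a - X t b| <= r -> Delta <= K t a b.
Proof. by move=> hG t a b; apply: hG; rewrite ?clamp01. Qed.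

Lemma ext_state_cvg (a l : R) : 0 <= a <= 1 ->
  X t a @[t --> +oo] --> l -> x t a @[t --> +oo] --> l.
Proof.
move=> a01; apply: cvg_trans; apply: near_eq_cvg.
by exists 0; split => // t t0; rewrite /X posE ?ltW// clampE.
Qed.

End weighted_dynamics.

Theorem theorem1p3 (R : realType) (w : R -> R -> R -> R -> R -> R)
    (x : R -> R -> R) (r Delta : R)
    (hw : weight_function w) (hx : is_solution w x)
    (hsym : weight_symmetric w x)
    (hr : 0 < r) (hDelta : 0 < Delta) (hGamma : weight_Gamma r Delta w x) :
  {ae (@completed_lebesgue_measure R), forall a : R, 0 <= a <= 1 ->
     cvg (x t a @[t --> +oo])} /\
  exists (k : nat) (z : 'I_k -> R),
    [/\ forall i, 0 <= z i <= 1,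
        forall i j, i != j -> r <= `|z i - z j| &
        {ae (@completed_lebesgue_measure R), forall a : R, 0 <= a <= 1 ->
           exists i, x t a @[t --> +oo] --> z i}].
Proof.
have [W flow] := ext_averaging_flow hw hx hsym.
have [k [z [z01 zsep zcvg]]] := averaging_flow_cvg flow hr hDelta
  (ext_weight_Gamma hGamma).
have aez : {ae (@completed_lebesgue_measure R), forall a : R, 0 <= a <= 1 ->
    exists i, x t a @[t --> +oo] --> z i}.
  apply: (ae_imply zcvg) => a H a01.
  have [|i Hi] := H; first by rewrite /= in_itv.
  by exists i; exact: ext_state_cvg.
split; last by exists k, z.
apply: (ae_imply aez) => a H a01; have [i Hi] := H a01.
by apply/cvg_ex; exists (z i).
Qed.
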